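(* For every partition $\lambda=[\lambda_1,\lambda_2,\dots,\lambda_k]$ (with $\lambda_1\ge\dots\ge\lambda_k>0$) one has $$\boldsymbol{\Gamma}^+_{\lambda_1}\boldsymbol{\Gamma}^+_{\lambda_2}\cdots\boldsymbol{\Gamma}^+_{\lambda_k}\cdot 1=J^{(q,t)}_\lambda,\qquad\text{where}\quad \boldsymbol{\Gamma}^+_m:=[u^m]\,\boldsymbol{\nabla}^{-1}\boldsymbol{\Gamma}(u,q^m)\boldsymbol{\nabla}.$$
   Context: Let $\Lambda$ be the algebra of symmetric functions in $x_1,x_2,\dots$ over $\mathbb{Q}(q,t)$, $X=x_1+x_2+\cdots$, with $p_\mu,h_n,m_\mu$ the power-sum, complete homogeneous and monomial symmetric functions; all operators are extended coefficientwise to $\Lambda[v][[u]]$. Plethystic notation: for an expression $E$ in $q,t,u,v,x_1,x_2,\dots$ and $f\in\Lambda$, $f[E]$ is the image of $f$ under the algebra morphism $p_k\mapsto E(q^k,t^k,u^k,v^k,x_1^k,x_2^k,\dots)$. The Hall scalar product is $\langle p_\mu,p_\nu\rangle=\delta_{\mu\nu}z_\mu$ with $z_\mu=\prod_i m_i(\mu)!\,i^{m_i(\mu)}$ ($m_i(\mu)$ the number of parts equal to $i$), and $\langle f,g\rangle_{q,t}:=\langle f[X],g[X\tfrac{1-q}{1-t}]\rangle$. $\mathcal{P}_Z$ denotes multiplication by $\mathrm{Exp}[ZX]:=\sum_{n\ge0}h_n[ZX]$. For a partition $\lambda$ with Young diagram $\{(i,j):1\le i\le\ell(\lambda),1\le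 j\le\lambda_i\}$ and a cell $\Box=(i,j)$: arm $a(\Box)=\lambda_i-j$, leg $\ell(\Box)=\lambda'_j-i$, co-arm $a'(\Box)=j-1$, co-leg $\ell'(\Box)=i-1$. $J^{(q,t)}_\lambda$ is the integral form of the Macdonald polynomial: $J^{(q,t)}_\lambda=\prod_{\Box\in\lambda}(1-q^{a(\Box)}t^{\ell(\Box)+1})P_\lambda$, where $(P_\lambda)$ is the unique family with $P_\lambda=m_\lambda+\sum_{\mu<\lambda}c_{\lambda\mu}m_\mu$ (dominance order) that is pairwise orthogonal for $\langle\cdot,\cdot\rangle_{q,t}$. The operators $\boldsymbol{\nabla}$ and $\boldsymbol{\Delta}_v$ are defined by $\boldsymbol{\nabla}J^{(q,t)}_\lambda=(-1)^{|\lambda|}\prod_{\Box\in\lambda}q^{a'(\Box)}t^{-\ell'(\Box)}J^{(q,t)}_\lambda$ and $\boldsymbol{\Delta}_vJ^{(q,t)}_\lambda=\prod_{\Box\in\lambda}(1-vq^{a'(\Box)}t^{-\ell'(\Box)})J^{(q,t)}_\lambda$, and $\boldsymbol{\Gamma}(u,v):=\boldsymbol{\Delta}_{1/v}\,\mathcal{P}_{\frac{uv(1-t)}{1-q}}\,\boldsymbol{\Delta}_{1/v}^{-1}$ (an operator polynomial in $v$). $[u^m]$ denotes extraction of the coefficient of $u^m$. *)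

(* Defs.v *)
From HB Require Import structures.
From mathcomp Require Import all_boot all_order all_algebra finmap.
From mathcomp Require Import mpoly monalg.

Set Implicit Arguments.
Unset Strict Implicit.
Unset Printing Implicit Defensive.

Import GRing.Theory.
Local Open Scope ring_scope.

(* Both mpoly and monalg declare this notation; here it is the former's. *)
Notation "{ 'mpoly' T [ n ] }" := (mpoly.mpoly n T) : type_scope.

(** * Partitions *)

Definition is_part (la : seq nat) : bool := sorted geq la && (0%N \notin la).

Definition strictly_dominated (mu la : seq nat) : Prop :=
  [/\ mu != la, sumn mu = sumn la
    & forall k, (sumn (take k mu) <= sumn (take k la))%N].

(* Rows and columns are numbered from 0, so that the cell written (i+1, j+1)
   in matrix coordinates has co-leg i and co-arm j. *)
Definition arm (la : seq nat) (i j : nat) : nat := (nth 0 la i - j.+1)%N.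
Definition leg (la : seq nat) (i j : nat) : nat :=
  (count (fun r => j < r) la - i.+1)%N.

Definition prod_cells (R : comNzRingType) (la : seq nat) (F : nat -> nat -> R)
    : R :=
  \prod_(i < size la) \prod_(j < nth 0%N la i) F i j.

(** * Symmetric functions *)

(* In characteristic 0 the ring of symmetric functions is the polynomial ring
   in the power sums p_1, p_2, ...; the generator [ucm i] stands for p_(i+1),
   so a monomial m : {cmonom nat} is the p_mu with m i parts equal to i+1.
   The elements are tied to actual symmetric polynomials by [in_vars] below. *)
Notation symfun R := {malg R[{cmonom nat}]}.

Definition psum (R : nzRingType) (k : nat) : symfun R := << ucm k.-1 >>.

(* The morphism that is iota on scalars and sends p_k to E k, for k >= 1.
   The plethysm f[E] is obtained with E k := E(q^k, t^k, u^k, v^k, x_i^k). *)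
Definition psubst (K S : comNzRingType) (iota : K -> S) (E : nat -> S)
    (f : symfun K) : S :=
  mmap iota (fun m : {cmonom nat} => \prod_(i <- finsupp m) E i.+1 ^+ m i) f.

(* f(x_1, ..., x_n, 0, 0, ...) *)
Definition in_vars (K : comNzRingType) (n : nat) (f : symfun K)
    : {mpoly K[n]} :=
  psubst (@mpolyC n K) (fun k => \sum_(i < n) 'X_i ^+ k) f.

(* m_mu(x_1, ..., x_n): the sum of the distinct monomials whose nonzero
   exponents are, up to order, the parts of mu. *)
Definition msym_poly (K : comNzRingType) (n : nat) (mu : seq nat)
    : {mpoly K[n]} :=
  \sum_(a : 'X_{1..n < (sumn mu).+1}
         | perm_eq [seq e <- (bmnm a : n.-tuple nat) | e != 0%N] mu)
    'X_[bmnm a].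

Lemma coef_prod_psum (K : fieldType) (n : nat) (s : seq nat)
    (al : mpoly.multinom n) :
  mpoly.mcoeff al (\prod_(e <- s) \sum_(i < n) ('X_i : {mpoly K[n]}) ^+ e)
  = #|[set phi : {ffun 'I_(size s) -> 'I_n} |
        [forall i, al i == \sum_(j | phi j == i) nth 0%N s j]%N]|%:R.
Proof.
rewrite (big_nth 0%N) big_mkord bigA_distr_bigA /= linear_sum /=.
rewrite -sum1_card natr_sum (bigID (mem [set phi : {ffun 'I_(size s) -> 'I_n} |
        [forall i, al i == \sum_(j | phi j == i) nth 0%N s j]%N])) /=.
rewrite [X in _ + X]big1 ?addr0 => [|phi].
  apply: eq_bigr => phi; rewrite inE => /forallP H.
  have -> : \prod_(i < size s) ('X_(phi i) : {mpoly K[n]}) ^+ nth 0%N s i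
      = 'X_[al].
    rewrite mpolyXE_id; rewrite (partition_big phi xpredT) //=.
    apply: eq_bigr => i _; rewrite (eqP (H i)) expr_sum.
    by apply: eq_bigr => j /eqP ->.
  by rewrite mcoeffX eqxx.
rewrite inE => H.
have -> : \prod_(i < size s) ('X_(phi i) : {mpoly K[n]}) ^+ nth 0%N s i
   = 'X_[Multinom [tuple (\sum_(j | phi j == i) nth 0%N s j)%N | i < n]].
  rewrite mpolyXE_id; rewrite (partition_big phi xpredT) //=.
  apply: eq_bigr => i _; rewrite mnmE expr_sum.
  by apply: eq_bigr => j /eqP ->.
rewrite mcoeffX; case: eqP => // E; case/negP: H; apply/forallP => i.
by rewrite -E mnmE.
Qed.

(* The parts of the partition mu such that m stands for p_mu. *)
Definition parts (m : {cmonom nat}) : seq nat :=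
  flatten [seq nseq (m i) i.+1 | i <- finsupp m].

Lemma prod_parts (S : comNzRingType) (E : nat -> S) (m : {cmonom nat}) :
  \prod_(i <- finsupp m) E i.+1 ^+ m i = \prod_(e <- parts m) E e.
Proof.
rewrite /parts big_flatten /= big_map; apply: eq_bigr => i _.
by rewrite big_nseq iter_mulr_1.
Qed.

Lemma size_parts m : size (parts m) = mdeg m.
Proof.
rewrite size_flatten /shape -map_comp mdegE sumnE big_map.
by apply: eq_bigr => i _ /=; rewrite size_nseq.
Qed.

Lemma count_parts m i : count_mem i.+1 (parts m) = m i.
Proof.
rewrite count_flatten -map_comp sumnE big_map.
under eq_bigr => j _ do rewrite /= count_nseq /= eqSS.
have [im|ni] := boolP (i \in finsupp m); last first.
  have -> : m i = 0%N by apply/eqP; rewrite cmE_eq0.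
  rewrite big1_seq // => j /= jm; case: eqP => [ji|]; rewrite ?mul0n //.
  by rewrite ji (negPf ni) in jm.
rewrite (bigD1_seq i) ?fset_uniq //=.
rewrite eqxx mul1n big1 ?addn0 // => j /negPf ->.
by rewrite mul0n.
Qed.

Lemma parts_gt0 m e : e \in parts m -> (0 < e)%N.
Proof.
by case/flattenP => s /mapP [i _ ->]; rewrite mem_nseq => /andP [_ /eqP ->].
Qed.

Lemma count_psum0 (K : fieldType) (n : nat) (s : seq nat)
    (al : mpoly.multinom n) :
  (forall i, 0 < al i)%N -> (size s <= n)%N ->
  mpoly.mcoeff al (\prod_(e <- s) \sum_(i < n) ('X_i : {mpoly K[n]}) ^+ e) != 0
  ->
  perm_eq s [seq al i | i : 'I_n].
Proof.
move=> al0 sn; rewrite coef_prod_psum.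
have [->|[phi]] := set_0Vmem [set phi : {ffun 'I_(size s) -> 'I_n} |
        [forall i, al i == \sum_(j | phi j == i) nth 0%N s j]%N].
  by rewrite cards0 eqxx.
rewrite inE => /forallP H _.
have sur i : i \in codom phi.
  apply/negPn/negP => ni; have := al0 i; rewrite (eqP (H i)) big1 //.
  by move=> j /eqP ji; case/negP: ni; rewrite -ji codom_f.
have cE : #|codom phi| = n.
  by rewrite -[RHS]card_ord; apply: eq_card => i; rewrite sur.
have nE : size s = n.
  apply/eqP; rewrite eqn_leq sn /=.
  by have := card_size (codom phi); rewrite cE size_codom card_ord.
have inj : injective phi.
  apply/injectiveP; rewrite /dinjectiveb; apply/card_uniqP.
  by rewrite size_codom card_ord cE.
have alE j : al (phi j) = nth 0%N s j.
  rewrite (eqP (H _)) (bigD1 j) //= big1 ?addn0 // => k.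
  move=> /andP [/eqP/inj -> /eqP].
  by [].
have -> : s = [seq al i | i <- codom phi].
  rewrite -map_comp -[LHS](mkseq_nth 0%N) /mkseq -val_enum_ord -map_comp.
  by apply: eq_map => j /=; rewrite alE.
apply: perm_map; apply: uniq_perm.
- by apply/injectiveP.
- exact: enum_uniq.
- by move=> i; rewrite sur mem_enum.
Qed.

Lemma count_psum1 (K : fieldType) (charK : [pchar K] =i pred0) (s : seq nat) :
  mpoly.mcoeff (Multinom (in_tuple s))
    (\prod_(e <- s) \sum_(i < size s) ('X_i : {mpoly K[size s]}) ^+ e) != 0.
Proof.
rewrite coef_prod_psum ((pcharf0P K).1 charK) cards_eq0.
apply/set0Pn; exists [ffun j => j]; rewrite inE.
apply/forallP => i; rewrite (bigD1 i) ?ffunE //= big1 ?addn0.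
  by rewrite mnm_tnth (tnth_nth 0%N).
by move=> j /andP [] /[!ffunE] ->.
Qed.

Lemma parts_inj (m m' : {cmonom nat}) :
  perm_eq (parts m) (parts m') -> m = m'.
Proof.
move=> /permP pp; apply/eqP/cmP => i.
by rewrite -!count_parts pp.
Qed.

Lemma in_varsE (K : fieldType) n (f : symfun K) : in_vars n f =
  \sum_(m <- msupp f) @mpolyC n K (mcoeff m f) *
     \prod_(e <- parts m) \sum_(i < n) 'X_i ^+ e.
Proof.
rewrite /in_vars /psubst mmapE; apply: eq_bigr => m _; congr (_ * _).
exact: prod_parts.
Qed.

Lemma in_varsB (K : fieldType) n (f g : symfun K) :
  in_vars n (f - g) = in_vars n f - in_vars n g.
Proof. exact: raddfB. Qed.

(* An element is determined by the symmetric polynomials it defines. *)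
Lemma in_vars_inj (K : fieldType) (charK : [pchar K] =i pred0)
    (f g : symfun K) :
  (forall n, in_vars n f = in_vars n g) -> f = g.
Proof.
move=> fg; apply/eqP; rewrite -subr_eq0.
have {fg}: forall n, in_vars n (f - g) = 0.
  by move=> n; rewrite in_varsB fg subrr.
move: (f - g) => {g}f f0; apply/negPn/negP => fN0.
have [m0 m0f] : exists m, m \in msupp f.
  by apply/fset0Pn; rewrite msupp_eq0.
have [m mf mmax] : exists2 m, m \in msupp f &
    forall m', m' \in msupp f -> (mdeg m' <= mdeg m)%N.
  pose m1 := [arg max_(i > (Sub m0 m0f : msupp f)) mdeg (val i)].
  exists (val m1); first exact: valP.
  move=> m' m'f; rewrite /m1; case: arg_maxnP => //= j _ /(_ (Sub m' m'f) isT).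
  by [].
have := f0 (size (parts m)); rewrite in_varsE.
move/(congr1 (mpoly.mcoeff (Multinom (in_tuple (parts m))))).
rewrite linear_sum /= mpoly.mcoeff0 (bigD1_seq m) ?fset_uniq //=.
rewrite [X in _ + X = _]big1_seq ?addr0.
  rewrite mpoly.mcoeffCM => /eqP; rewrite mulf_eq0.
  by rewrite (negPf (count_psum1 charK _)) orbF mcoeff_eq0 mf.
move=> m' /andP [m'm m'f]; rewrite mpoly.mcoeffCM.
apply/eqP; rewrite mulf_eq0; apply/orP; right.
apply: contraNT m'm => /count_psum0 H; apply/eqP/parts_inj.
have -> : parts m = [seq (Multinom (in_tuple (parts m))) i
                       | i : 'I_(size (parts m))].
  rewrite -[LHS](mkseq_nth 0%N) /mkseq -val_enum_ord -map_comp.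
  by apply: eq_map => j /=; rewrite mnm_tnth (tnth_nth 0%N).
apply: H; last by rewrite !size_parts mmax.
by move=> i; rewrite mnm_tnth; apply: (@parts_gt0 m); apply: mem_tnth.
Qed.

(* h_n = sum over mu |- n of p_mu / z_mu, where mu has a i parts equal to
   i+1. *)
Definition hsym (K : fieldType) (n : nat) : symfun K :=
  \sum_(a : {ffun 'I_n -> 'I_n.+1} | (\sum_(i < n) a i * i.+1 == n)%N)
    (\prod_(i < n) ((a i)`! * i.+1 ^ a i))%N%:R^-1
      *: \prod_(i < n) psum K i.+1 ^+ a i.

Definition zcoef (m : {cmonom nat}) : nat :=
  \prod_(i <- finsupp m) ((m i)`! * i.+1 ^ m i)%N.

Definition hall (K : fieldType) (f g : symfun K) : K :=
  \sum_(m <- msupp f) (zcoef m)%:R * mcoeff m f * mcoeff m g.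

Definition hall_qt (K : fieldType) (q t : K) (f g : symfun K) : K :=
  hall f (psubst (malgC : K -> symfun K)
            (fun k => ((1 - q ^+ k) / (1 - t ^+ k)) *: psum K k) g).

(** * Macdonald polynomials *)

Record is_macdonaldP (K : fieldType) (q t : K) (P : seq nat -> symfun K)
    : Prop := {
  macdonaldP_triangular : forall la, is_part la ->
    exists (c : seq nat -> K) (s : seq (seq nat)),
      {in s, forall mu, is_part mu /\ strictly_dominated mu la} /\
      forall n, in_vars n (P la)
        = msym_poly K n la + \sum_(mu <- s) c mu *: msym_poly K n mu;
  macdonaldP_orthogonal : forall la mu, is_part la -> is_part mu -> la != mu ->
    hall_qt q t (P la) (P mu) = 0
}.

Definition integral_form (K : fieldType) (q t : K) (P : seq nat -> symfun K)
    (la : seq nat) : symfun K :=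
  prod_cells la (fun i j => 1 - q ^+ arm la i j * t ^+ (leg la i j).+1) *: P la.

(** * Operators *)

Definition is_nabla (K : fieldType) (q t : K) (J : seq nat -> symfun K)
    (nabla : symfun K -> symfun K) : Prop :=
  forall la, is_part la ->
    nabla (J la)
      = ((-1) ^+ sumn la * prod_cells la (fun i j => q ^+ j * t ^- i)) *: J la.

Definition is_Delta (K : fieldType) (q t v : K) (J : seq nat -> symfun K)
    (Delta : symfun K -> symfun K) : Prop :=
  forall la, is_part la ->
    Delta (J la) = prod_cells la (fun i j => 1 - v * (q ^+ j * t ^- i)) *: J la.

(* phi applied to the coefficients in the power-sum basis. *)
Definition map_coef (K L : comNzRingType) (phi : K -> L) (f : symfun K)
    : symfun L := \sum_(m <- msupp f) << phi (mcoeff m f) *g m >>.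

(* The field K(v), its generator v and the inclusion of K. *)
Notation ratfun K := {fraction {poly K}}.
Definition rv (K : fieldType) : ratfun K := FracField.tofrac 'X.
Definition rconst (K : fieldType) (c : K) : ratfun K := FracField.tofrac c%:P.

(* The value at v = a of a rational function in v, computed in lowest terms;
   it is the usual one as soon as there is no pole at a. *)
Definition rat_eval (K : fieldType) (a : K) (r : ratfun K) : K :=
  let n := \n_(repr r) in let d := \d_(repr r) in let g := gcdp n d in
  (n %/ g).[a] / (d %/ g).[a].

Lemma fracE (R : idomainType) (r : {fraction R}) :
  r = FracField.tofrac \n_(repr r) / FracField.tofrac \d_(repr r).
Proof.
have dP := denom_ratioP (repr r).
apply/(canRL (mulfK _)); first by rewrite tofrac_eq0.
rewrite -{1}[r]reprK; move: (repr r) dP => x dP; unlock FracField.tofrac.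
rewrite -[LHS]FracField.pi_mul; apply/eqmodP => /=.
rewrite FracField.equivfE /FracField.mulf !numden_Ratio ?oner_eq0 ?mulr1 //.
by rewrite mulrC.
Qed.

Lemma rat_evalE (K : fieldType) (a : K) (p d : {poly K}) : d.[a] != 0 ->
  rat_eval a (FracField.tofrac p / FracField.tofrac d) = p.[a] / d.[a].
Proof.
move=> da; have d0 : d != 0 by apply: contraNneq da => ->; rewrite horner0.
rewrite /rat_eval; set r := FracField.tofrac p / FracField.tofrac d.
set n := \n_(repr r); set e := \d_(repr r).
have e0 : e != 0 by exact: denom_ratioP.
have E : n * d = p * e.
  apply/eqP; rewrite -tofrac_eq !tofracM; apply/eqP.
  have /eqP := fracE r; rewrite -/n -/e /r eqr_div ?tofrac_eq0 //.
  by rewrite eq_sym => /eqP.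
set g := gcdp n e.
have g0 : g != 0 by rewrite gcdp_eq0 negb_and e0 orbT.
have nE : n %/ g * g = n by rewrite divpK // dvdp_gcdl.
have eE : e %/ g * g = e by rewrite divpK // dvdp_gcdr.
have cop : coprimep (e %/ g) (n %/ g).
  by rewrite coprimep_sym coprimep_div_gcd // e0 orbT.
have {}E : (n %/ g) * d = p * (e %/ g).
  by apply: (mulIf g0); rewrite mulrAC nE E -mulrA eE.
have dv : e %/ g %| d.
  by rewrite -(Gauss_dvdpr _ cop) E dvdp_mull.
have ea : (e %/ g).[a] != 0.
  by apply: contraNneq da => ea0; rewrite -(divpK dv) hornerM ea0 mulr0.
by apply/eqP; rewrite eqr_div // -!hornerM E.
Qed.

(* The coefficient of u^m in Exp[u v (1-t)/(1-q) X], a power series in u.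
   Since h_n[u Y] is divisible by u^n, the terms n > m of Exp do not
   contribute; below, the variable of {poly symfun K} is u. *)
Definition Exp_coef (K : fieldType) (q t v : K) (m : nat) : symfun K :=
  (\sum_(n < m.+1)
     psubst (fun c : K => (c%:MP : symfun K)%:P)
       (fun k => ((v ^+ k * (1 - t ^+ k) / (1 - q ^+ k)) *: psum K k)%:P
                   * 'X ^+ k)
       (hsym K n))`_m.

(* [u^m] Gamma(u, v), acting on symmetric functions over K(v). *)
Definition Gamma_coef (K : fieldType) (q t : K)
    (Delta DeltaV : symfun (ratfun K) -> symfun (ratfun K)) (m : nat)
    (f : symfun (ratfun K)) : symfun (ratfun K) :=
  Delta (Exp_coef (rconst q) (rconst t) (rv K) m * DeltaV f).

(* Delta_(1/v) is not invertible at v = q^m, so Gamma(u, v) is formed for an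
   indeterminate v; it is specialised to v = q^m afterwards. *)
Definition Gamma_plus (K : fieldType) (q t : K)
    (nabla nablaV : symfun K -> symfun K)
    (Delta DeltaV : symfun (ratfun K) -> symfun (ratfun K)) (m : nat)
    (f : symfun K) : symfun K :=
  nablaV (map_coef (rat_eval (q ^+ m))
    (Gamma_coef q t Delta DeltaV m (map_coef (@rconst K) (nabla f)))).

(** * The base field Q(q, t) *)

Notation Qqt := {fraction {mpoly rat[2]}}.
Definition qvar : Qqt := FracField.tofrac 'X_ord0.
Definition tvar : Qqt := FracField.tofrac 'X_ord_max.

(* Main.v *)
(* Write N(la) = <P_la, P_la>_(q,t), let g_k be the coefficient of u^k in
   Exp[u X (1 - t)/(1 - q)], and la^- be la without its first column. Multiplication
   by g_k is adjoint to f |-> [y^k] f[X + y], so triangularity of P shows that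
   <g_k P_si, P_la> <> 0 forces (k, si) <= la in the dominance order, while
   <e_l P_ta, P_la> <> 0 forces la <= ta + 1^l. Since exp turns both
   G(qz) E(-tz) and G(z) E(-z) into the same series, for G and E the generating
   series of the g_k and e_l,
     sum_(k + l = n) (q^k t^l - 1) (-1)^l g_k e_l = 0.
   Pairing this with the P_la for which n >= la_1 + l(la) - 1 shows, by induction on
   |la|, that <g_k P_si, P_la> with k = la_1 vanishes unless si is la
   without its first row, and dually for e_l with l = l(la) and the first column.
   For la = (m, ka) of length r it also gives
     (1 - q^m t^(r-1)) N(ka) N(la^-) = (1 - q^(m-1) t^r) N(ka^-) N(la).
   Hence g_m P_mu is a multiple of P_(m,mu) plus terms P_nu with nu_1 > m. The
   latter are killed because the eigenvalue of Delta_(1/v) on them vanishes at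
   v = q^m, and the norm recursion turns the remaining coefficient into the ratio
   of the normalisations of J_(m,mu) and J_mu. *)

From HB Require Import structures.
Require Import Defs.
From mathcomp Require Import all_boot all_order all_algebra finmap.
From mathcomp Require Import mpoly monalg.
From mathcomp Require Import ring zify.

Set Implicit Arguments.
Unset Strict Implicit.
Unset Printing Implicit Defensive.

Import GRing.Theory.
Local Open Scope ring_scope.

(** * The power-sum basis *)

(* Comparing two distinct basis elements << m >> by conversion unfolds the finite
   map library; the lock prevents this. *)
HB.lock Definition pmon (K : comNzRingType) (m : {cmonom nat}) : symfun K := << m >>.

HB.lock Definition umul (i : nat) (m : {cmonom nat}) : {cmonom nat} := mmul (ucm i) m.
HB.lock Definition udiv (i : nat) (m : {cmonom nat}) : {cmonom nat} := divcm m (ucm i).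

Lemma umulE i (m : {cmonom nat}) j : umul i m j = ((i == j) + m j)%N.
Proof. by rewrite umul.unlock mulcmE ucmE. Qed.

Lemma udivE i (m : {cmonom nat}) j : udiv i m j = (m j - (i == j))%N.
Proof. by rewrite udiv.unlock divcmE ucmE. Qed.

Lemma udivK i (m : {cmonom nat}) : m i != 0%N -> umul i (udiv i m) = m.
Proof.
move=> mi; apply/eqP/cmP => j; rewrite umulE udivE subnKC //.
by case: eqP => // <-; rewrite lt0n.
Qed.

Lemma umulK i : cancel (umul i) (udiv i).
Proof. by move=> m; apply/eqP/cmP => j; rewrite udivE umulE addKn. Qed.

Lemma mdeg_ind (Q : {cmonom nat} -> Prop) :
  Q mone -> (forall i m, Q m -> Q (umul i m)) -> forall m, Q m.
Proof.
move=> Q1 QS m; have [n] := ubnP (monalg.mdeg m).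
elim: n m => // n IH m mn.
have [/eqP ->//|m1] := boolP (m == mone).
have [i im] : exists i, i \in finsupp m.
  apply/fset0Pn; apply: contraNneq m1 => m0.
  by rewrite -monalg.mdeg_eq0 mdegE m0 big_seq_fset0.
have mi : m i != 0%N by rewrite cmE_neq0.
rewrite -(udivK mi); apply/QS/IH; rewrite -(udivK mi) in mn.
by move: mn; rewrite umul.unlock monalg.mdegM mdegU ltnS.
Qed.

Section PowerSumAlgebra.

Variable K : comNzRingType.
Implicit Types f g : symfun K.

Lemma pmonE m : pmon K m = << m >>.
Proof. by rewrite pmon.unlock. Qed.

Lemma pmon1 : pmon K mone = 1.
Proof. by rewrite pmon.unlock. Qed.

Lemma psum_pmon i m : psum K i.+1 * pmon K m = pmon K (umul i m).
Proof. by rewrite pmon.unlock umul.unlock malgM_def fgmulUU mulr1. Qed.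

Lemma mcoeff_pmon m m' : mcoeff m (pmon K m') = (m' == m)%:R.
Proof. by rewrite pmon.unlock mcoeffU1. Qed.

Lemma malgUE c m : << c *g m >> = c *: pmon K m.
Proof.
apply/malgP=> k; rewrite mcoeffZ [in RHS]mcoeff_pmon mulr_natr.
exact: mcoeffU.
Qed.

Lemma malg_ind (Q : symfun K -> Prop) :
  (forall f g, Q f -> Q g -> Q (f + g)) ->
  (forall c f, Q f -> Q (c *: f)) ->
  (forall m, Q (pmon K m)) -> forall f, Q f.
Proof.
move=> QD QZ QU f; rewrite (monalgE f).
have Q0 : Q 0 by rewrite -(scale0r (pmon K mone)); apply/QZ/QU.
elim/big_ind: _ => [||m _]; [exact: Q0 | exact: QD |].
exact: (eq_ind_r Q (QZ (mcoeff m f) _ (QU m)) (malgUE _ m)).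
Qed.

Lemma symfun_ind (Q : symfun K -> Prop) :
  Q 1 -> (forall f g, Q f -> Q g -> Q (f + g)) ->
  (forall c f, Q f -> Q (c *: f)) ->
  (forall i f, Q f -> Q (psum K i.+1 * f)) -> forall f, Q f.
Proof.
move=> Q1 QD QZ QM; apply: malg_ind => [||m]; [exact: QD | exact: QZ |].
elim/mdeg_ind: m => [|i m Qm]; first by rewrite pmon1.
by rewrite -psum_pmon; apply: QM.
Qed.

End PowerSumAlgebra.

Section PowerSumSubst.

Variables (K S : comNzRingType) (iota : {rmorphism K -> S}) (E : nat -> S).

Let h (m : {cmonom nat}) : S := \prod_(i <- finsupp m) E i.+1 ^+ m i.

Lemma prod_cmonomEw (d : {fset nat}) (m : {cmonom nat}) : (finsupp m `<=` d)%fset ->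
  \prod_(i <- finsupp m) E i.+1 ^+ m i = \prod_(i <- d) E i.+1 ^+ m i.
Proof.
move=> le; apply: big_fset_incl => // x xd xm.
by move: xm; rewrite -cmE_eq0 => /eqP ->.
Qed.

Lemma prod_cmonom_mmorphism : mmorphism h.
Proof.
split=> [m m'|]; last by rewrite /h mdom1 big_seq_fset0.
rewrite /h mdomD (prod_cmonomEw (fsubsetUl _ (finsupp m'))).
rewrite (prod_cmonomEw (fsubsetUr (finsupp m) _)) -big_split /=.
by apply: eq_bigr => i _; rewrite cmM exprD.
Qed.

HB.instance Definition _ := isMultiplicative.Build _ _ h prod_cmonom_mmorphism.

HB.instance Definition _ :=
  GRing.RMorphism.copy (psubst iota E) (mmap iota h).

Lemma psubstZ c (f : symfun K) : psubst iota E (c *: f) = iota c * psubst iota E f.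
Proof. exact: (@mmapZ _ _ _ iota h c f). Qed.

Lemma psubst_psum i : psubst iota E (psum K i.+1) = E i.+1.
Proof.
by rewrite /psubst mmapU [X in X * _](rmorph1 iota) mul1r mdomU big_seq_fset1 cmUU.
Qed.

Lemma psubst_pmon m : psubst iota E (pmon K m) = h m.
Proof. by rewrite pmon.unlock /psubst mmapU [X in X * _](rmorph1 iota) mul1r. Qed.

Lemma prod_cmonom_umul i (m : {cmonom nat}) : \prod_(j <- finsupp (umul i m)) E j.+1 ^+ umul i m j =
  E i.+1 * \prod_(j <- finsupp m) E j.+1 ^+ m j.
Proof.
have -> : E i.+1 = h (ucm i) by rewrite /h mdomU big_seq_fset1 cmUU.
rewrite umul.unlock; exact: prod_cmonom_mmorphism.1.
Qed.

End PowerSumSubst.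

Section Translation.

Variable K : comNzRingType.
Implicit Types f g : symfun K.

(* f[X + y] as a polynomial in y. *)
Definition polyMC : {rmorphism K -> {poly symfun K}} := polyC \o @malgC _ K.

Definition translate : symfun K -> {poly symfun K} :=
  psubst polyMC (fun k => (psum K k)%:P + 'X^k).

HB.instance Definition _ := GRing.RMorphism.on translate.

Definition skewp k f : symfun K := (translate f)`_k.

Lemma skew_is_additive k : additive (skewp k).
Proof. by move=> f g; rewrite /skewp rmorphB coefB. Qed.

HB.instance Definition _ k := GRing.isAdditive.Build _ _ (skewp k) (skew_is_additive k).

Lemma skewZ k c f : skewp k (c *: f) = c *: skewp k f.
Proof. by rewrite /skewp /translate psubstZ /= coefCM mul_malgC. Qed.

HB.instance Definition _ k := GRing.isScalable.Build _ _ _ _ (skewp k) (skewZ k).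

Lemma skewM k f g : skewp k (f * g) = \sum_(i < k.+1) skewp i f * skewp (k - i) g.
Proof. by rewrite /skewp rmorphM coefM. Qed.

Lemma skew_one k : skewp k 1 = (k == 0%N)%:R.
Proof. by rewrite /skewp rmorph1 coef1. Qed.

Lemma translate_psum i : translate (psum K i.+1) = (psum K i.+1)%:P + 'X^(i.+1).
Proof. by rewrite /translate psubst_psum. Qed.

Lemma skew_psumM k i f : skewp k (psum K i.+1 * f) =
  psum K i.+1 * skewp k f + (if (i < k)%N then skewp (k - i.+1) f else 0).
Proof.
rewrite /skewp (rmorphM translate) /= translate_psum mulrDl coefD coefCM.
by rewrite coefXnM ltnS leqNgt; case: ltnP.
Qed.

Lemma skew0 f : skewp 0 f = f.
Proof.
elim/symfun_ind: f => [|f g IHf IHg|c f IH|i f IH].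
- exact: skew_one.
- by rewrite raddfD /= IHf IHg.
- by rewrite skewZ IH.
- by rewrite skew_psumM IH addr0.
Qed.

(* The coefficient of x_1^(a_1) ... x_n^(a_n) in f(x_1, ..., x_n). *)
Fixpoint mcoef (al : seq nat) f : K :=
  if al is a :: al' then mcoef al' (skewp a f) else mcoeff mone f.

Lemma mcoef_is_additive al : additive (mcoef al).
Proof.
elim: al => [|a al IH] f g /=; first exact: mcoeffB.
by rewrite raddfB IH.
Qed.

HB.instance Definition _ al :=
  GRing.isAdditive.Build _ _ (mcoef al) (mcoef_is_additive al).

Lemma mcoefZ al c f : mcoef al (c *: f) = c * mcoef al f.
Proof. by elim: al f => [|a al IH] f /=; rewrite ?mcoeffZ // skewZ IH. Qed.

HB.instance Definition _ al :=
  GRing.isScalable.Build _ _ _ _ (mcoef al) (mcoefZ al).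

Lemma mcoef_cat0 al k f : mcoef (al ++ nseq k 0%N) f = mcoef al f.
Proof.
elim: al f => [|a al IH] f //=; elim: k f => //= k IH f.
by rewrite skew0 IH.
Qed.

Lemma mcoef_one al : mcoef al 1 = (all (pred1 0%N) al)%:R.
Proof.
elim: al => [|a al IH] /=; first by rewrite mcoeff1 eqxx.
by rewrite skew_one; case: eqP => //= _; rewrite raddf0.
Qed.

Definition subn_at (al : seq nat) j k := set_nth 0%N al j (nth 0 al j - k)%N.

Lemma mcoef_psumM al i f : mcoef al (psum K i.+1 * f) =
  \sum_(j < size al) if (i < nth 0 al j)%N then mcoef (subn_at al j i.+1) f else 0.
Proof.
elim: al f => [|a al IH] f /=.
  by rewrite big_ord0 rmorphM /= mcoeffU1 cm1_eq1 mul0r.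
rewrite skew_psumM raddfD /= IH big_ord_recl /= addrC; congr (_ + _).
by case: ifP => _ //; rewrite raddf0.
Qed.

End Translation.

Lemma mcoeff_mulX (R : comNzRingType) n (p : mpoly.mpoly n R) (m k : mpoly.multinom n) :
  mpoly.mcoeff k (p * mpolyX R m)
    = if [forall i, m i <= k i]%N then mpoly.mcoeff (mnm_sub k m) p else 0.
Proof.
case: ifP => [/forallP mk|mk].
  have kE : k = mnm_add m (mnm_sub k m).
    by apply/mnmP => i; rewrite mnmDE mnmBE subnKC.
  by rewrite {1}kE mpoly.mcoeffMX.
apply/eqP; rewrite mpoly.mcoeff_eq0 (perm_mem (msuppMX _ _)).
apply: contraFN mk => /mapP[m' _ ->]; apply/forallP => i.
by rewrite mnmDE leq_addr.
Qed.

Lemma mcoeff_in_vars (K : fieldType) n (f : symfun K) (al : mpoly.multinom n) :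
  mpoly.mcoeff al (in_vars n f) = mcoef al f.
Proof.
rewrite /in_vars; elim/symfun_ind: f al => [|f g IHf IHg|c f IH|i f IH] al.
- rewrite rmorph1 mpoly.mcoeff1 mcoef_one; congr (_%:R : K); congr (nat_of_bool _).
  apply/eqP/all_tnthP => [-> j|al0] /=.
    by have := mnm0E j; rewrite mnm_tnth => /eqP.
  by apply/mnmP => j; rewrite mnm0E; apply/eqP; have := al0 j.
- by rewrite rmorphD /= mpoly.mcoeffD IHf IHg raddfD.
- by rewrite psubstZ mpoly.mcoeffCM IH mcoefZ.
rewrite rmorphM /= psubst_psum mulr_suml raddf_sum /= mcoef_psumM size_tuple.
apply: eq_bigr => j _; rewrite mulrC mpolyXn mcoeff_mulX.
have -> : [forall l, (mnm_muln U_(j) i.+1 l <= al l)%N] = (i < nth 0 al j)%N.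
  rewrite -mnm_nth; apply/forallP/idP => [/(_ j)|ij l].
    by rewrite mulmnE mnm1E eqxx mul1n.
  by rewrite mulmnE mnm1E; case: eqP => [<-|]; rewrite ?mul1n.
case: ifP => // ij; rewrite IH; congr (mcoef _ f).
apply: (@eq_from_nth _ 0%N).
  by rewrite size_set_nth !size_tuple; apply/esym/maxn_idPr.
move=> l; rewrite size_tuple => ln; rewrite nth_set_nth.
have E (m : mpoly.multinom n) : nth 0%N m l = m (Ordinal ln).
  by rewrite (mnm_nth 0%N).
rewrite [LHS]E mnmBE mulmnE mnm1E -E [in RHS]/=.
rewrite -[l == j :> nat]/(Ordinal ln == j) eq_sym.
by case: eqP => [<-|_]; rewrite ?mul1n // mul0n subn0.
Qed.

Lemma mcoef_inj (K : fieldType) (charK : [pchar K] =i pred0) (f : symfun K) :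
  (forall al, mcoef al f = 0) -> f = 0.
Proof.
move=> f0; apply: (in_vars_inj charK) => n; apply/mpolyP => al.
by rewrite mcoeff_in_vars f0 [in_vars n 0]raddf0 mpoly.mcoeff0.
Qed.

(** * Derivations and the scalar product *)

Section Derivation.

Variable K : comNzRingType.
Implicit Types f g : symfun K.

Lemma prod_psum_monom (m : {cmonom nat}) :
  \prod_(i <- finsupp m) psum K i.+1 ^+ m i = pmon K m.
Proof.
elim/mdeg_ind: m => [|i m IH]; first by rewrite pmon1 mdom1 big_seq_fset0.
by rewrite prod_cmonom_umul IH psum_pmon.
Qed.

End Derivation.

(* der i is the partial derivative along p_(i+1). *)
HB.lock Definition der (K : comNzRingType) (i : nat) (f : symfun K) : symfun K :=
  mmap (@malgC _ K) (fun m : {cmonom nat} => (m i)%:R *: pmon K (udiv i m)) f.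

Section DerivationTheory.

Variable K : comNzRingType.

Lemma der_is_additive i : additive (@der K i).
Proof. by move=> f g; rewrite der.unlock raddfB. Qed.

HB.instance Definition _ i := GRing.isAdditive.Build _ _ (@der K i) (der_is_additive i).

Lemma der_pmon i (m : {cmonom nat}) : der i (pmon K m) = (m i)%:R *: pmon K (udiv i m).
Proof. by rewrite der.unlock [in LHS]pmonE mmapU mul_malgC scale1r. Qed.

Lemma derZ i c (f : symfun K) : der i (c *: f) = c *: der i f.
Proof.
rewrite der.unlock (mmapEw (msuppZ_le c f)) mmapE scaler_sumr; apply: eq_bigr => m _.
by rewrite mcoeffZ [LHS]mul_malgC [X in _ = _ *: X]mul_malgC [RHS]scalerA.
Qed.

HB.instance Definition _ i := GRing.isScalable.Build _ _ _ _ (@der K i) (derZ i).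

Lemma derD i (f g : symfun K) : der i (f + g) = der i f + der i g.
Proof. exact: raddfD. Qed.

Lemma der_one i : der i (1 : symfun K) = 0.
Proof. by rewrite -pmon1 der_pmon cm1 scale0r. Qed.

End DerivationTheory.

(* Stated for an arbitrary algebra because comparing products in symfun K by
   conversion is intractable. *)
Section GenericDerivation.

Variables (K : comNzRingType) (A : comAlgType K).
Variables (p : nat -> A) (b : {cmonom nat} -> A) (d : nat -> A -> A).
Hypothesis A_ind : forall Q : A -> Prop,
  (forall f g, Q f -> Q g -> Q (f + g)) -> (forall c f, Q f -> Q (c *: f)) ->
  (forall m, Q (b m)) -> forall f, Q f.
Hypothesis p_b : forall i m, p i * b m = b (umul i m).
Hypothesis dD : forall i f g, d i (f + g) = d i f + d i g.
Hypothesis dZ : forall i c f, d i (c *: f) = c *: d i f.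
Hypothesis d_b : forall i m, d i (b m) = (m i)%:R *: b (udiv i m).

Lemma generic_der_mul i j f : d i (p j * f) = (if i == j then f else 0) + p j * d i f.
Proof.
elim/A_ind: f => [f g IHf IHg|c f IH|m].
- rewrite mulrDr !dD IHf IHg mulrDr addrACA; congr (_ + _).
  by case: eqP; rewrite ?addr0.
- rewrite -scalerAr !dZ IH scalerDr -scalerAr; congr (_ + _).
  by case: eqP; rewrite ?scaler0.
rewrite p_b !d_b umulE -scalerAr p_b.
have [<-|ij] := eqVneq i j.
  rewrite umulK natrD scalerDl scale1r; congr (_ + _).
  by have [->|mi] := eqVneq (m i) 0%N; [rewrite !scale0r | rewrite udivK].
rewrite add0r add0n.
have [->|mi] := eqVneq (m i) 0%N; first by rewrite !scale0r.
suff -> : udiv i (umul j m) = umul j (udiv i m) by [].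
apply/eqP/cmP => l; rewrite udivE !umulE udivE addnBA //.
by case: eqP => // <-; rewrite lt0n.
Qed.

End GenericDerivation.

Lemma der_psumM (K : comNzRingType) i j (f : symfun K) :
  der i (psum K j.+1 * f) = (if i == j then f else 0) + psum K j.+1 * der i f.
Proof.
exact: (generic_der_mul (@malg_ind K) (@psum_pmon K) (@derD K) (@derZ K) (@der_pmon K)).
Qed.

Section GenericPairing.

Variables (K : comNzRingType) (A : comAlgType K).
Variables (p : nat -> A) (b : {cmonom nat} -> A) (d : nat -> A -> A).
Variables (B : A -> A -> K) (coef : {cmonom nat} -> A -> K).
Variables (w : {cmonom nat} -> K) (c : nat -> K).
Hypothesis A_ind : forall Q : A -> Prop,
  (forall f g, Q f -> Q g -> Q (f + g)) -> (forall c f, Q f -> Q (c *: f)) ->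
  (forall m, Q (b m)) -> forall f, Q f.
Hypothesis p_b : forall i m, p i * b m = b (umul i m).
Hypothesis dD : forall i f g, d i (f + g) = d i f + d i g.
Hypothesis dZ : forall i c f, d i (c *: f) = c *: d i f.
Hypothesis d_b : forall i m, d i (b m) = (m i)%:R *: b (udiv i m).
Hypothesis coefD : forall m f g, coef m (f + g) = coef m f + coef m g.
Hypothesis coefZ : forall m c f, coef m (c *: f) = c * coef m f.
Hypothesis coef_b : forall m m', coef m (b m') = (m' == m)%:R.
Hypothesis BDl : forall f f' g, B (f + f') g = B f g + B f' g.
Hypothesis BZl : forall a f g, B (a *: f) g = a * B f g.
Hypothesis B_b : forall m g, B (b m) g = w m * coef m g.
Hypothesis wM : forall i (m : {cmonom nat}),
  w (umul i m) = (c i.+1 * (i.+1 * (m i).+1)%:R) * w m.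

Lemma generic_pairingDr f g g' : B f (g + g') = B f g + B f g'.
Proof.
elim/A_ind: f => [f f' IHf IHf'|a f IH|m].
- by rewrite !BDl IHf IHf' addrACA.
- by rewrite !BZl IH mulrDr.
by rewrite !B_b coefD mulrDr.
Qed.

Lemma generic_pairingZr a f g : B f (a *: g) = a * B f g.
Proof.
elim/A_ind: f => [f f' IHf IHf'|a' f IH|m].
- by rewrite !BDl IHf IHf' mulrDr.
- by rewrite !BZl IH mulrCA.
by rewrite !B_b coefZ mulrCA.
Qed.

Lemma generic_pairingC f g : B f g = B g f.
Proof.
elim/A_ind: f => [f f' IHf IHf'|a f IH|m].
- by rewrite BDl generic_pairingDr IHf IHf'.
- by rewrite BZl generic_pairingZr IH.
elim/A_ind: g => [f f' IHf IHf'|a f IH|m'].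
- by rewrite BDl generic_pairingDr IHf IHf'.
- by rewrite BZl generic_pairingZr IH.
rewrite !B_b !coef_b eq_sym.
by case: eqP => [->|] //; rewrite !mulr0.
Qed.

Lemma generic_pairing_mull i f g : B (p i * f) g = c i.+1 * i.+1%:R * B f (d i g).
Proof.
elim/A_ind: f => [f f' IHf IHf'|a f IH|m].
- by rewrite mulrDr !BDl IHf IHf' mulrDr.
- by rewrite -scalerAr !BZl IH mulrCA.
elim/A_ind: g => [f f' IHf IHf'|a f IH|m'].
- by rewrite dD !generic_pairingDr IHf IHf' mulrDr.
- by rewrite dZ !generic_pairingZr IH mulrCA.
rewrite p_b !B_b d_b coefZ !coef_b wM.
have [->|m'i] := eqVneq m' (umul i m).
  rewrite umulK eqxx umulE eqxx add1n natrM.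
  move: (c _) (w _) (m i) => x y z; ring.
have [->|] := eqVneq (m' i) 0%N; first by rewrite mul0r !mulr0.
move=> mi0; case: eqP => [E|_]; last by rewrite !mulr0.
by case/eqP: m'i; rewrite -E udivK.
Qed.

Variables (phi : A -> A) (u : {cmonom nat} -> K).
Hypothesis phiD : forall f g, phi (f + g) = phi f + phi g.
Hypothesis phiZ : forall c f, phi (c *: f) = c *: phi f.
Hypothesis phi_b : forall m, phi (b m) = u m *: b m.

Lemma generic_coef_diag m f : coef m (phi f) = u m * coef m f.
Proof.
elim/A_ind: f => [f g IHf IHg|a f IH|m'].
- by rewrite phiD !coefD IHf IHg mulrDr.
- by rewrite phiZ !coefZ IH mulrCA.
by rewrite phi_b coefZ coef_b; case: eqP => [->|]; rewrite ?mulr0.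
Qed.

End GenericPairing.

Section HallPairing.

Variables (K : fieldType) (c : nat -> K).
Implicit Types f g : symfun K.

Definition plet : symfun K -> symfun K :=
  psubst (malgC : K -> symfun K) (fun k => c k *: psum K k).

HB.instance Definition _ := GRing.RMorphism.on plet.

Lemma pletZ a f : plet (a *: f) = a *: plet f.
Proof. by rewrite /plet psubstZ mul_malgC. Qed.

HB.instance Definition _ := GRing.isScalable.Build _ _ _ _ plet pletZ.

Definition monom_weight (m : {cmonom nat}) : K := \prod_(i <- finsupp m) c i.+1 ^+ m i.

Lemma plet_pmon m : plet (pmon K m) = monom_weight m *: pmon K m.
Proof.
rewrite /plet psubst_pmon.
rewrite -[in RHS]prod_psum_monom /monom_weight -scaler_prod.
by apply: eq_bigr => i _; rewrite exprZn.
Qed.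

Lemma pletD f g : plet (f + g) = plet f + plet g.
Proof. exact: raddfD. Qed.

Lemma mcoeff_plet m f : mcoeff m (plet f) = monom_weight m * mcoeff m f.
Proof.
exact: (generic_coef_diag (@malg_ind K) (@mcoeffD _ _) (fun m c f => mcoeffZ c f m)
  (@mcoeff_pmon K) pletD pletZ plet_pmon).
Qed.

Definition pairing f g := hall f (plet g).

Definition pairing_weight (m : {cmonom nat}) : K := (zcoef m)%:R * monom_weight m.

Lemma pairingE f g : pairing f g =
  mmap (S := K) idfun (fun m => pairing_weight m * mcoeff m g) f.
Proof.
rewrite /pairing /hall mmapE; apply: eq_bigr => m _.
by rewrite mcoeff_plet /pairing_weight /=; ring.
Qed.

Lemma pairingDl f f' g : pairing (f + f') g = pairing f g + pairing f' g.
Proof. by rewrite !pairingE; exact: mmapD. Qed.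

Lemma pairingZl a f g : pairing (a *: f) g = a * pairing f g.
Proof.
rewrite !pairingE (mmapEw (msuppZ_le a f)) mmapE mulr_sumr; apply: eq_bigr => m _.
by rewrite mcoeffZ; exact/esym/mulrA.
Qed.

Lemma pairing_pmonl m g : pairing (pmon K m) g = pairing_weight m * mcoeff m g.
Proof. by rewrite pairingE pmon.unlock mmapU mul1r. Qed.

Lemma pairing_weightM (i : nat) m :
  pairing_weight (umul i m) = (c i.+1 * (i.+1 * (m i).+1)%:R) * pairing_weight m.
Proof.
pose E j n : K := (n`! * j.+1 ^ n)%N%:R * c j.+1 ^+ n.
have wE (m' : {cmonom nat}) (d : {fset nat}) : (finsupp m' `<=` d)%fset ->
    pairing_weight m' = \prod_(j <- d) E j (m' j).
  move=> le; rewrite /pairing_weight /zcoef /monom_weight natr_prod -big_split /=.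
  apply: big_fset_incl => // x xd xm.
  by move: xm; rewrite -cmE_eq0 => /eqP ->; rewrite mul1r.
pose d := (i |` finsupp m)%fset.
have le1 : (finsupp m `<=` d)%fset by exact: fsubsetUr.
have le2 : (finsupp (umul i m) `<=` d)%fset.
  by rewrite umul.unlock (mdomD (ucm i) m) mdomU.
rewrite [LHS](wE _ _ le2) [X in _ = _ * X](wE _ _ le1).
have id : i \in d by exact: fset1U1.
rewrite [LHS](big_fsetD1 i id) [X in _ = _ * X](big_fsetD1 i id) /= mulrA; congr (_ * _).
  have -> : umul i m i = (m i).+1 by rewrite umulE eqxx.
  move: (m i) => x; rewrite /E factS expnS exprS !natrM.
  ring.
rewrite big_seq [RHS]big_seq; apply: eq_bigr => j.
by rewrite in_fsetD1 umulE eq_sym => /andP[/negPf -> _].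
Qed.

Let pairing_psuml_gen :=
  generic_pairing_mull (@malg_ind K) (@psum_pmon K) (@derD K) (@derZ K) (@der_pmon K)
    (@mcoeffD _ _) (fun m c f => mcoeffZ c f m) (@mcoeff_pmon K) pairingDl pairingZl
    pairing_pmonl pairing_weightM.

Lemma pairing_psuml i f g :
  pairing (psum K i.+1 * f) g = c i.+1 * i.+1%:R * pairing f (der i g).
Proof. exact: pairing_psuml_gen. Qed.

Lemma pairingC f g : pairing f g = pairing g f.
Proof.
exact: (generic_pairingC (@malg_ind K) (@mcoeffD _ _) (fun m c f => mcoeffZ c f m)
  (@mcoeff_pmon K) pairingDl pairingZl pairing_pmonl).
Qed.

Hypothesis charK : [pchar K] =i pred0.
Hypothesis c_neq0 : forall k, c k.+1 != 0.

Lemma pairing_inj f : (forall g, pairing f g = 0) -> f = 0.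
Proof.
move=> f0; apply/malgP => m; rewrite mcoeff0.
have := f0 (pmon K m); rewrite pairingC pairing_pmonl => /eqP.
rewrite mulf_eq0 => /orP[|/eqP //].
have z0 : (0 < zcoef m)%N.
  by rewrite /zcoef; apply: prodn_gt0 => i; rewrite muln_gt0 fact_gt0 expn_gt0.
rewrite mulf_eq0 ((pcharf0P K).1 charK) eqn0Ngt z0 /=.
by rewrite prodf_seq_eq0 => /hasP[i _]; rewrite expf_eq0 (negPf (c_neq0 i)) andbF.
Qed.

End HallPairing.

(* The coefficient of x_1^(a_1) ... x_n^(a_n) in a symmetric function, for the
   operators D k f = [y^k] f[X + y] and the constant term eps. *)
Fixpoint coef_seq (R : Type) (A : Type) (eps : A -> R) (D : nat -> A -> A)
    (al : seq nat) (f : A) : R :=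
  if al is a :: al' then coef_seq eps D al' (D a f) else eps f.

(* The structure of symfun K, with p_(i+1) = sf_p i and with a pairing for which
   <p_mu, p_mu> = z_mu * prod_i w (mu_i). Abstracting from symfun K is needed since
   comparing its elements by conversion is intractable. *)
Record symfun_theory (K : fieldType) (w : nat -> K) := SymfunTheory {
  sf_alg : comAlgType K;
  sf_p : nat -> sf_alg;
  sf_skew : nat -> {linear sf_alg -> sf_alg};
  sf_der : nat -> {linear sf_alg -> sf_alg};
  sf_eps : {scalar sf_alg};
  sf_pair : sf_alg -> sf_alg -> K;
  sf_ind : forall Q : sf_alg -> Prop,
    Q 1 -> (forall f g, Q f -> Q g -> Q (f + g)) ->
    (forall c f, Q f -> Q (c *: f)) -> (forall i f, Q f -> Q (sf_p i * f)) ->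
    forall f, Q f;
  sf_skew0 : forall f, sf_skew 0 f = f;
  sf_skew1 : forall k, sf_skew k 1 = (k == 0%N)%:R;
  sf_skewM : forall k f g, sf_skew k (f * g) =
    \sum_(i < k.+1) sf_skew i f * sf_skew (k - i) g;
  sf_skew_p : forall k i f, sf_skew k (sf_p i * f) =
    sf_p i * sf_skew k f + (if (i < k)%N then sf_skew (k - i.+1) f else 0);
  sf_der1 : forall i, sf_der i 1 = 0;
  sf_der_p : forall i j f, sf_der i (sf_p j * f) =
    (if i == j then f else 0) + sf_p j * sf_der i f;
  sf_eps_p : forall i f, sf_eps (sf_p i * f) = 0;
  sf_pairDl : forall f f' g, sf_pair (f + f') g = sf_pair f g + sf_pair f' g;
  sf_pairZl : forall a f g, sf_pair (a *: f) g = a * sf_pair f g;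
  sf_pairC : forall f g, sf_pair f g = sf_pair g f;
  sf_pair_p : forall i f g, sf_pair (sf_p i * f) g =
    w i.+1 * i.+1%:R * sf_pair f (sf_der i g);
  sf_pair_inj : forall f, (forall g, sf_pair f g = 0) -> f = 0;
  sf_coef_inj : forall f, (forall al, coef_seq sf_eps sf_skew al f = 0) -> f = 0
}.

(* The coefficients of exp (sum_k c_k p_k / k). *)
Definition newton (K : comNzRingType) (A : comAlgType K) (p : nat -> A)
    (c : nat -> K) (H : nat -> A) : Prop :=
  H 0%N = 1 /\
  forall n, n.+1%:R * H n.+1 = \sum_(k < n.+1) c k.+1 *: p k * H (n - k)%N.

Section Newton.

Variables (K : fieldType) (A : comAlgType K) (p : nat -> A).
Hypothesis charK : [pchar K] =i pred0.

Lemma natrS_inj n (f g : A) : n.+1%:R * f = n.+1%:R * g -> f = g.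
Proof.
have n0 : n.+1%:R != 0 :> K by rewrite ((pcharf0P K).1 charK).
rewrite !mulr_natl -!scaler_nat.
by move/(congr1 ( *:%R n.+1%:R^-1)); rewrite !scalerA mulVf // !scale1r.

Qed.

Lemma newton_unique c H H' : newton p c H -> newton p c H' -> H =1 H'.
Proof.
move=> [H0 HS] [H0' HS'] n; elim/ltn_ind: n => -[_|n IH]; first by rewrite H0 H0'.
apply: (@natrS_inj n); rewrite HS HS'; apply: eq_bigr => k _.
by rewrite IH // ltnS leq_subr.
Qed.

Lemma newton_scale c H x : newton p c H ->
  newton p (fun k => x ^+ k * c k) (fun n => x ^+ n *: H n).
Proof.
move=> [H0 HS]; split=> [|n]; first by rewrite H0 expr0 scale1r.
rewrite -scalerAr HS scaler_sumr; apply: eq_bigr => k _.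
rewrite -!scalerAl -!scalerAr !scalerA; congr (_ *: _).
rewrite mulrAC -exprD; congr (_ ^+ _ * _).
by rewrite addSn subnKC // -ltnS.
Qed.

Lemma newton_conv c c' H H' : newton p c H -> newton p c' H' ->
  newton p (fun k => c k + c' k) (fun n => \sum_(i < n.+1) H i * H' (n - i)%N).
Proof.
move=> [H0 HS] [H0' HS']; split=> [|n]; first by rewrite big_ord1 H0 H0' mulr1.
pose P := \poly_(i < n.+2) H i; pose P' := \poly_(i < n.+2) H' i.
pose C := \poly_(i < n.+1) (c i.+1 *: p i); pose C' := \poly_(i < n.+1) (c' i.+1 *: p i).
have convE k : (k < n.+2)%N -> (P * P')`_k = \sum_(i < k.+1) H i * H' (k - i)%N.
  move=> kn; rewrite coefM; apply: eq_bigr => i _; rewrite !coef_poly.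
  by rewrite (leq_ltn_trans (leq_subr _ _) kn) (leq_trans (ltn_ord i) kn).
have derE (Q : {poly A}) (G : nat -> A) (d : nat -> K) (E : {poly A}) k :
    (forall i, (i < n.+2)%N -> Q`_i = G i) ->
    (forall i, (i < n.+1)%N -> E`_i = d i.+1 *: p i) ->
    (forall i, i.+1%:R * G i.+1 = \sum_(j < i.+1) d j.+1 *: p j * G (i - j)%N) ->
    (k < n.+1)%N -> Q^`()`_k = (E * Q)`_k.
  move=> QE EE GS kn; rewrite coef_deriv QE // -mulr_natl GS coefM.
  apply: eq_bigr => i _; rewrite EE ?QE //.
    by rewrite (leq_ltn_trans (leq_subr _ _)) // ltnW.
  exact: leq_trans (ltn_ord i) kn.
have PE i : (i < n.+2)%N -> P`_i = H i by move=> ik; rewrite coef_poly ik.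
have PE' i : (i < n.+2)%N -> P'`_i = H' i by move=> ik; rewrite coef_poly ik.
have CE i : (i < n.+1)%N -> C`_i = c i.+1 *: p i by move=> ik; rewrite coef_poly ik.
have CE' i : (i < n.+1)%N -> C'`_i = c' i.+1 *: p i by move=> ik; rewrite coef_poly ik.
have modE (Q Q' R : {poly A}) :
    (forall k, (k < n.+1)%N -> Q`_k = Q'`_k) -> (Q * R)`_n = (Q' * R)`_n.
  by move=> QQ; rewrite !coefM; apply: eq_bigr => i _; rewrite QQ.
have dE : (P * P')^`()`_n = ((C + C') * (P * P'))`_n.
  rewrite derivM coefD mulrDl coefD; congr (_ + _).
    by rewrite mulrA; apply: modE => k; apply: derE PE CE HS.
  rewrite [C' * _]mulrCA ![P * _]mulrC.
  by apply: modE => k; apply: derE PE' CE' HS'.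
transitivity ((P * P')^`()`_n); first by rewrite coef_deriv convE // mulr_natl.
rewrite dE coefM; apply: eq_bigr => k _.
by rewrite coefD CE // CE' // -scalerDl convE // ltnS (leq_trans (leq_subr _ _)).
Qed.

End Newton.

Section SymfunTheory.

Variables (K : fieldType) (w : nat -> K) (S : symfun_theory w).
Hypothesis charK : [pchar K] =i pred0.

Local Notation A := (sf_alg S).
Local Notation p := (sf_p S).
Local Notation D := (sf_skew S).
Local Notation B := (@sf_pair _ _ S).
Local Notation der := (sf_der S).
Implicit Types f g h : A.

Lemma skew_der n f :
  n.+1%:R * D n.+1 f = \sum_(k < n.+1) k.+1%:R * D (n - k) (der k f).
Proof.
elim/(@sf_ind _ _ S): f n => [|f g IHf IHg|c f IH|i f IH] n.
- by rewrite sf_skew1 mulr0 big1 // => k _; rewrite sf_der1 raddf0 mulr0.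
- rewrite raddfD mulrDr IHf IHg -big_split; apply: eq_bigr => k _.
  by rewrite !raddfD /= mulrDr.
- rewrite linearZ /= -scalerAr IH scaler_sumr; apply: eq_bigr => k _.
  by rewrite !linearZ /= -scalerAr.
have E (k : 'I_n.+1) : k.+1%:R * D (n - k) (der k (p i * f))
    = (if k == i :> nat then i.+1%:R * D (n - i) f else 0)
    + (p i * (k.+1%:R * D (n - k) (der k f))
    + if (i < n - k)%N then k.+1%:R * D (n - i.+1 - k) (der k f) else 0).
  rewrite sf_der_p raddfD /= sf_skew_p mulrDr; congr (_ + _).
    by case: eqP => [->|] //; rewrite raddf0 mulr0.
  rewrite mulrDr mulrCA; congr (_ + _).
  by rewrite subnAC; case: ifP => // _; rewrite mulr0.
rewrite (eq_bigr _ (fun k _ => E k)) !big_split /= -mulr_sumr -IH.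
rewrite sf_skew_p mulrDr mulrCA addrCA; congr (_ + _).
rewrite -!big_mkcond /=; case: ifP => [|/negbT]; last first.
  rewrite -leqNgt => ni; rewrite !big_pred0 ?mulr0 ?addr0 // => k.
    by apply/negbTE; rewrite -leqNgt (leq_trans (leq_subr _ _)) // ltnW.
  by apply/negbTE; rewrite neq_ltn (leq_trans (ltn_ord k) ni).
move=> ni; rewrite subSS (big_pred1 (Ordinal ni)) //.
have [->|{}ni'] := eqVneq n i.
  rewrite big_pred0 ?addr0 // => k.
  by apply/negbTE; rewrite -leqNgt leq_subr.
have {}ni' : (i < n)%N by rewrite ltn_neqAle eq_sym ni' -ltnS.
have nE : (n - i = (n - i.+1).+1)%N by rewrite subnSK.
rewrite [in LHS]nE.
have -> : n.+1%:R = i.+1%:R + (n - i.+1).+1%:R :> A.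
  by rewrite -natrD -nE addSn subnKC // ltnW.
rewrite mulrDl -[in X in X + _]nE; congr (_ + _); rewrite IH.
rewrite (big_ord_widen_cond n.+1 xpredT
   (fun k => k.+1%:R * D (n - i.+1 - k) (der k f))) /=; last first.
  by rewrite -nE leqW ?leq_subr.
apply: eq_bigl => k.
by rewrite -nE /= !ltn_subRL addnC.
Qed.

Lemma pairDr f g g' : B f (g + g') = B f g + B f g'.
Proof. by rewrite ![B f _]sf_pairC sf_pairDl. Qed.

Lemma pairZr a f g : B f (a *: g) = a * B f g.
Proof. by rewrite ![B f _]sf_pairC sf_pairZl. Qed.

Lemma pair0l f : B 0 f = 0.
Proof. by rewrite -(scale0r 0) sf_pairZl mul0r. Qed.

Lemma pair0r f : B f 0 = 0.
Proof. by rewrite sf_pairC pair0l. Qed.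

Lemma pair_suml I (r : seq I) (P : pred I) (F : I -> A) g :
  B (\sum_(i <- r | P i) F i) g = \sum_(i <- r | P i) B (F i) g.
Proof. by apply: (big_morph (fun f => B f g)) => [f f'|]; [apply: sf_pairDl | apply: pair0l]. Qed.

Lemma pair_sumr I (r : seq I) (P : pred I) (F : I -> A) g :
  B g (\sum_(i <- r | P i) F i) = \sum_(i <- r | P i) B g (F i).
Proof. by rewrite sf_pairC pair_suml; apply: eq_bigr => i _; apply: sf_pairC. Qed.

Lemma pair_natl n f g : B (n%:R * f) g = n%:R * B f g.
Proof. by rewrite mulr_natl -scaler_nat sf_pairZl. Qed.

Lemma pair_natr n f g : B f (n%:R * g) = n%:R * B f g.
Proof. by rewrite mulr_natl -scaler_nat pairZr. Qed.

Lemma pair_skew c G n f h : (forall k, c k.+1 * w k.+1 = 1) -> newton p c G ->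
  B (G n * f) h = B f (D n h).
Proof.
move=> cw [G0 GS]; elim/ltn_ind: n f h => -[_|n IH] f h.
  by rewrite G0 mul1r sf_skew0.
apply: (@mulfI _ n.+1%:R); first by rewrite ((pcharf0P K).1 charK).
rewrite -pair_natl -pair_natr mulrA GS skew_der mulr_suml pair_suml pair_sumr.
apply: eq_bigr => k _; rewrite -mulrA -scalerAl sf_pairZl sf_pair_p.
rewrite IH ?ltnS ?leq_subr // pair_natr !mulrA cw mul1r; congr (_ * _).
Qed.

End SymfunTheory.

Section ElementaryComplete.

Variables (K : fieldType) (w : nat -> K) (S : symfun_theory w).
Hypothesis charK : [pchar K] =i pred0.

Local Notation A := (sf_alg S).
Local Notation p := (sf_p S).
Local Notation D := (sf_skew S).
Local Notation B := (@sf_pair _ _ S).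
Local Notation der := (sf_der S).
Local Notation mc := (coef_seq (@sf_eps _ _ S) D).
Implicit Types f g h : A.

Lemma coef_seqB al f g : mc al (f - g) = mc al f - mc al g.
Proof. by elim: al f g => [|a al IH] f g /=; rewrite linearB. Qed.

Lemma coef_seq0 al : mc al 0 = 0.
Proof. by rewrite -[X in mc _ X](subrr 0) coef_seqB subrr. Qed.

Lemma coef_seqN al f : mc al (- f) = - mc al f.
Proof. by rewrite -sub0r coef_seqB coef_seq0 sub0r. Qed.

Lemma coef_seqD al f g : mc al (f + g) = mc al f + mc al g.
Proof. by rewrite -[g in LHS]opprK coef_seqB coef_seqN opprK. Qed.

Lemma coef_seqZ al c f : mc al (c *: f) = c * mc al f.
Proof. by elim: al f => [|a al IH] f /=; rewrite linearZ ?IH. Qed.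

Lemma coef_seq_sum al I (r : seq I) (P : pred I) (F : I -> A) :
  mc al (\sum_(i <- r | P i) F i) = \sum_(i <- r | P i) mc al (F i).
Proof. by apply: (big_morph (mc al)) => [f g|]; [apply: coef_seqD | apply: coef_seq0]. Qed.

Lemma coef_seq_cat0 al n f : mc (al ++ nseq n 0%N) f = mc al f.
Proof.
elim: al f => [|a al IH] f //=; elim: n f => //= n IH f.
by rewrite sf_skew0.
Qed.

(* The signed elementary symmetric functions (-1)^n e_n. *)
Variable E : nat -> A.
Hypothesis newtonE : newton p (fun=> -1) E.

Lemma newton_elemS n : n.+1%:R * E n.+1 = - \sum_(k < n.+1) p k * E (n - k)%N.
Proof.
rewrite newtonE.2 -sumrN; apply: eq_bigr => k _.
by rewrite scaleN1r mulNr.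
Qed.

Lemma skew_elem0 l : D 1 (E l) = if l is l'.+1 then - E l' else 0.
Proof.
elim/ltn_ind: l => -[_|l IH]; first by rewrite newtonE.1 sf_skew1.
apply: (natrS_inj charK (n := l)).
have -> : l.+1%:R * D 1 (E l.+1) = D 1 (l.+1%:R * E l.+1).
  by rewrite !mulr_natl linearMn.
rewrite newton_elemS linearN linear_sum /=.
under eq_bigr => k _ do rewrite sf_skew_p.
have -> : \sum_(k < l.+1) (p k * D 1 (E (l - k)%N)
    + (if (k < 1)%N then D (1 - k.+1) (E (l - k)%N) else 0))
  = \sum_(k < l.+1) p k * D 1 (E (l - k)%N) + E l.
  rewrite big_split /=; congr (_ + _).
  rewrite (bigD1 ord0) //= subn0 subnn sf_skew0 big1 ?addr0 //.
  by case=> [[|k] lk].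
rewrite mulrN opprD.
rewrite big_ord_recr /= subnn newtonE.1 sf_skew1 mulr0 addr0.
rewrite -natr1 mulrDl mul1r opprD; congr (_ - _).
rewrite -sumrN; under eq_bigr => k _.
  rewrite IH ?ltnS ?leq_subr //.
  rewrite -(subnSK (ltn_ord k)) mulrN opprK.
  over.
by case: l {IH} => [|l]; rewrite ?big_ord0 ?mul0r ?oppr0 // newton_elemS opprK.
Qed.

Lemma skew_elem_ge2 k l : D k.+2 (E l) = 0.
Proof.
elim/ltn_ind: l k => -[_|l IH] k; first by rewrite newtonE.1 sf_skew1.
apply: (natrS_inj charK (n := l)).
have -> : l.+1%:R * D k.+2 (E l.+1) = D k.+2 (l.+1%:R * E l.+1).
  by rewrite !mulr_natl linearMn.
rewrite newton_elemS linearN linear_sum /= mulr0.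
under eq_bigr => j _ do rewrite sf_skew_p IH ?ltnS ?leq_subr // mulr0 add0r.
have Djk j : (j < l.+1)%N -> (if (j < k.+2)%N then D (k.+2 - j.+1) (E (l - j)) else 0)
   = (if j == k.+1 then E (l - k.+1) else 0)
     - (if (j == k) && (k < l)%N then E (l - k.+1) else 0).
  move=> jl; have [->|jk1] := eqVneq j k.+1.
    by rewrite ltnSn subnn sf_skew0 eqn_leq ltnn subr0.
  have [->|jk] := eqVneq j k.
    rewrite ltnS leqnSn subSS subSnn skew_elem0 sub0r.
    case: ltnP => kl /=; first by rewrite -(subnSK kl).
    have -> : (l - k = 0)%N by lia.
    by rewrite oppr0.
  rewrite subr0; case: ifP => // jk2.
  have -> : (k.+2 - j.+1 = (k - j.+1).+2)%N by lia.
  by rewrite IH //; lia.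
rewrite (eq_bigr _ (fun j _ => Djk _ (ltn_ord j))) sumrB -!big_mkcond /=.
case: (ltnP k l) => kl; last first.
  rewrite !big_pred0 ?subrr ?oppr0 // => j; first by rewrite andbF.
  by have := ltn_ord j; lia.
rewrite (big_pred1 (inord k.+1)) => [|j]; last by rewrite /= -val_eqE /= inordK.
rewrite (big_pred1 (inord k)) => [|j]; first by rewrite subrr oppr0.
by rewrite /= -val_eqE /= inordK ?andbT // ltnW.
Qed.

Lemma skew_elemM k l f : D k (E l * f) = E l * D k f -
  (if k is k'.+1 then if l is l'.+1 then E l' * D k' f else 0 else 0).
Proof.
rewrite sf_skewM big_ord_recl sf_skew0 subn0; congr (_ + _).
case: k => [|k]; first by rewrite big_ord0 oppr0.
rewrite big_ord_recl /bump /= skew_elem0 subSS subn0 big1 ?addr0; last first.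
  by move=> j _; rewrite skew_elem_ge2 mul0r.
by case: l => [|l]; rewrite ?mul0r ?oppr0 // mulNr.
Qed.

Lemma eps_elemM l f : sf_eps S (E l.+1 * f) = 0.
Proof.
have n0 : l.+1%:R != 0 :> K by rewrite ((pcharf0P K).1 charK).
have : sf_eps S (l.+1%:R *: (E l.+1 * f)) = 0.
  rewrite scaler_nat -mulrnAl -mulr_natl newton_elemS mulNr linearN mulr_suml linear_sum /=.
  by rewrite big1 ?oppr0 // => k _; rewrite -mulrA sf_eps_p.
by rewrite linearZ /= => /eqP; rewrite mulf_eq0 (negPf n0) => /eqP.
Qed.

Lemma coef_elemM_neq0 al l f : mc al (E l * f) != 0 -> exists be,
  [/\ mc be f != 0, sumn al = (l + sumn be)%N
    & forall j, (sumn (take j al) <= minn j l + sumn (take j be))%N].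
Proof.
elim: al l f => [|a al IH] l f /=.
  case: l => [|l]; last by rewrite eps_elemM eqxx.
  by rewrite newtonE.1 mul1r => f0; exists [::]; split.
have step l' a' f' : mc al (E l' * D a' f') != 0 -> exists be,
  [/\ mc (a' :: be) f' != 0, (a + sumn al = l' + a + sumn be)%N
    & forall j, (sumn (take j al) <= minn j l' + sumn (take j be))%N].
  by case/IH => be [b1 b2 b3]; exists be; split => //; rewrite b2; lia.
rewrite skew_elemM coef_seqB.
have [->|n0 _] := eqVneq (mc al (E l * D a f)) 0; last first.
  have [be [b1 b2 b3]] := step _ _ _ n0; exists (a :: be); split => //=; first lia.
  by case=> [|j] //=; have := b3 j; lia.
rewrite sub0r oppr_eq0; case: a step => [|a] step; first by rewrite coef_seq0 eqxx.
case: l => [|l] h; first by rewrite coef_seq0 eqxx in h.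
have [be [b1 b2 b3]] := step _ _ _ h; exists (a :: be); split => //=; first lia.
by case=> [|j] //=; have := b3 j; lia.
Qed.

Lemma coef_elemM_col al f :
  mc (map succn al) (E (size al) * f) = (-1) ^+ size al * mc al f.
Proof.
elim: al f => [|a al IH] f /=; first by rewrite newtonE.1 !mul1r.
rewrite skew_elemM coef_seqB IH exprS mulN1r mulNr.
have [->|] := eqVneq (mc (map succn al) (E (size al).+1 * D a.+1 f)) 0.
  by rewrite sub0r.
case/coef_elemM_neq0 => be [_ b2 b3]; have := b3 (size al).
rewrite take_oversize ?size_map // b2.
have : (sumn (take (size al) be) <= sumn be)%N.
  by rewrite -{2}(cat_take_drop (size al) be) sumn_cat leq_addr.
lia.
Qed.

Lemma newton_ext c c' H : (forall k, c k.+1 = c' k.+1) -> newton p c H -> newton p c' H.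
Proof.
by move=> cc [H0 HS]; split=> // n; rewrite HS; apply: eq_bigr => k _; rewrite cc.
Qed.

(* With G(z) = sum_n G_n z^n and E(z) = sum_n E_n z^n, the series G(qz) E(tz) and
   G(z) E(z) are both exp (sum_k (q^k - t^k)/(1 - q^k) p_k z^k / k). *)
Lemma complete_elem_relation (q t : K) (G : nat -> A) n :
  (forall k, 1 - q ^+ k.+1 != 0) ->
  newton p (fun k => (1 - t ^+ k) / (1 - q ^+ k)) G ->
  \sum_(i < n.+1) (q ^+ i * t ^+ (n - i) - 1) *: (G i * E (n - i)%N) = 0.
Proof.
move=> q1 NG.
have N1 := newton_conv (newton_scale q NG) (newton_scale t newtonE).
have N2 := newton_conv NG newtonE.
have N3 : newton p (fun k => (1 - t ^+ k) / (1 - q ^+ k) + -1)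
   (fun n => \sum_(i < n.+1) (q ^+ i *: G i) * (t ^+ (n - i) *: E (n - i)%N)).
  apply: newton_ext N1 => k /=; have := q1 k.
  by move: (q ^+ k.+1) (t ^+ k.+1) => x y x1; field.
have := newton_unique charK N3 N2 n => /eqP; rewrite -subr_eq0 -sumrB => /eqP E0.
rewrite -[RHS]E0; apply: eq_bigr => i _.
by rewrite scalerBl scale1r -scalerAl -scalerAr scalerA.
Qed.

End ElementaryComplete.

(** * Dominance order and the Macdonald basis *)

Section Partitions.

Implicit Types (la mu al : seq nat).

Local Open Scope nat_scope.

Definition dom al la : Prop :=
  sumn al = sumn la /\ forall j, sumn (take j al) <= sumn (take j la).

Lemma dom_trans al la mu : dom al la -> dom la mu -> dom al mu.
Proof. by move=> [e1 h1] [e2 h2]; split=> [|j]; [rewrite e1 | apply: leq_trans (h1 j) _]. Qed.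

Lemma sumn_take_le j al : sumn (take j al) <= sumn al.
Proof. by rewrite -{2}(cat_take_drop j al) sumn_cat leq_addr. Qed.

Lemma sumn_takeS j al : sumn (take j.+1 al) = sumn (take j al) + nth 0 al j.
Proof. by elim: al j => [|a al IH] [|j] //=; rewrite ?take0 ?addn0 //= IH addnA. Qed.

Lemma is_part_cons m ka : is_part (m :: ka) = [&& 0 < m, head 0 ka <= m & is_part ka].
Proof.
rewrite /is_part inE negb_or eq_sym -lt0n /=; case: ka => [|k ka] /=; first by rewrite !andbT.
by case: (0 < m); case: (path _ _ _); case: (_ \notin _); rewrite ?andbF ?andbT //= /geq.
Qed.

Lemma is_part_nth_gt0 la i : is_part la -> (0 < nth 0 la i) = (i < size la).
Proof.
move=> /andP[_ la0]; have [il|li] := ltnP i (size la); last by rewrite nth_default.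
by rewrite lt0n; apply: contraNneq la0 => <-; apply: mem_nth.
Qed.

Lemma is_part_ext la mu : is_part la -> is_part mu ->
  (forall i, nth 0 la i = nth 0 mu i) -> la = mu.
Proof.
move=> pl pm e; have sE : size la = size mu.
  have H i : (i < size la) = (i < size mu).
    by rewrite -(is_part_nth_gt0 i pl) e (is_part_nth_gt0 i pm).
  by have := H (size la); have := H (size mu); lia.
by apply: (eq_from_nth (x0 := 0)) => // i _; apply: e.
Qed.

Lemma is_part_take_ext la mu : is_part la -> is_part mu ->
  (forall j, sumn (take j la) = sumn (take j mu)) -> la = mu.
Proof.
move=> pl pm e; apply: is_part_ext => // i; have := e i.+1.
by rewrite !sumn_takeS e => /addnI.
Qed.

Lemma dom_antisym la mu : is_part la -> is_part mu -> dom la mu -> dom mu la -> la = mu.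
Proof.
move=> pl pm [_ h1] [_ h2]; apply: is_part_take_ext => // j.
by apply/eqP; rewrite eqn_leq h1 h2.
Qed.

Lemma is_part_size la : is_part la -> size la <= sumn la.
Proof. by elim: la => //= m la IH; rewrite is_part_cons => /and3P[m0 _ /IH]; lia. Qed.

Lemma is_part_nth_le la i j : is_part la -> i <= j -> nth 0 la j <= nth 0 la i.
Proof.
move=> /andP[sl _] ij; have [js|sj] := ltnP j (size la); last by rewrite [nth 0 la j]nth_default.
have tr : transitive geq by move=> a b c; rewrite /geq /= => h1 h2; apply: leq_trans h2 h1.
by apply: (sorted_leq_nth tr leqnn 0 sl); rewrite ?inE // (leq_ltn_trans ij js).
Qed.

Fixpoint bounded_seqs (n b : nat) : seq (seq nat) :=
  if n is n'.+1 then
    [::] :: [seq a :: s | a <- iota 0 b.+1, s <- bounded_seqs n' b]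
  else [:: [::]].

Definition parts_upto b : seq (seq nat) :=
  undup [seq la <- bounded_seqs b b | is_part la].

Lemma mem_parts_upto b la : is_part la -> sumn la <= b -> la \in parts_upto b.
Proof.
move=> pl lb; rewrite mem_undup mem_filter pl /=.
have H n (al : seq nat) : size al <= n -> sumn al <= b -> al \in bounded_seqs n b.
  elim: n al => [|n IH] [|a al] // sl lb'; rewrite inE.
  apply/orP; right; apply/allpairsP; exists (a, al); split=> //.
    by rewrite mem_iota; move: lb'; rewrite /=; lia.
  by apply: IH => //; move: lb'; rewrite /=; lia.
by apply: H => //; apply: leq_trans (is_part_size pl) lb.
Qed.

Lemma parts_upto_part b la : la \in parts_upto b -> is_part la.
Proof. by rewrite mem_undup mem_filter => /andP[]. Qed.

Definition dom_rank b la := \sum_(j < b.+1) sumn (take j la).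

Lemma dom_rank_le b al la : dom al la -> dom_rank b al <= dom_rank b la.
Proof. by move=> [_ h]; apply: leq_sum => j _; apply: h. Qed.

Lemma dom_rank_eq b la mu : is_part la -> is_part mu -> sumn la <= b -> dom la mu ->
  dom_rank b la = dom_rank b mu -> la = mu.
Proof.
move=> pl pm lb [e h] re; apply: is_part_take_ext => // j.
have H (i : 'I_b.+1) : sumn (take i la) = sumn (take i mu).
  have : (\sum_(i < b.+1) (sumn (take i mu) - sumn (take i la)) == 0)%N.
    by rewrite sumnB => [|k _]; [rewrite -/(dom_rank b mu) -/(dom_rank b la) re subnn | apply: h].
  rewrite sum_nat_eq0 => /forallP /(_ i) /= /eqP; have := h i; lia.
have [jb|bj] := ltnP j b.+1; first exact: (H (Ordinal jb)).
have sl := is_part_size pl; have sm := is_part_size pm.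
by rewrite !take_oversize //; lia.
Qed.

Lemma dom_rank_bound b la : sumn la <= b -> dom_rank b la <= b.+1 * b.
Proof.
move=> lb; rewrite -[X in X * b]card_ord -sum_nat_const; apply: leq_sum => j _.
exact: leq_trans (sumn_take_le _ _) lb.
Qed.

End Partitions.

Section MacdonaldBasis.

Variables (K : fieldType) (w : nat -> K) (S : symfun_theory w).
Hypothesis charK : [pchar K] =i pred0.

Local Notation A := (sf_alg S).
Local Notation p := (sf_p S).
Local Notation D := (sf_skew S).
Local Notation B := (@sf_pair _ _ S).
Local Notation mc := (coef_seq (@sf_eps _ _ S) D).
Implicit Types (f g h : A) (la mu nu : seq nat).

Lemma skewC a b f : D a (D b f) = D b (D a f).
Proof.
elim/(@sf_ind _ _ S): f a b => [|f g IHf IHg|c f IH|i f IH] a b.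
- rewrite !sf_skew1; case: a b => [|a] [|b] //=;
    by rewrite ?sf_skew0 ?sf_skew1 ?linear0.
- by rewrite !linearD /= IHf IHg.
- by rewrite !linearZ /= IH.
rewrite !sf_skew_p !linearD /= !sf_skew_p (IH a b) -!addrA; congr (_ + _).
case: (ltnP i a) => _; case: (ltnP i b) => _; rewrite ?linear0 ?addr0 ?add0r //.
by rewrite (IH (a - i.+1)%N b) (IH a (b - i.+1)%N) addrC.
Qed.

Lemma coef_seq_perm al be f : perm_eq al be -> mc al f = mc be f.
Proof.
pose Ds al f := foldl (fun f a => D a f) f al.
have mcE ga g : mc ga g = sf_eps S (Ds ga g) by elim: ga g => //= c ga IH g.
have DsC c ga g : D c (Ds ga g) = Ds ga (D c g).
  by elim: ga g => //= d ga IH g; rewrite IH skewC.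
have DsCs ga de g : Ds ga (Ds de g) = Ds de (Ds ga g).
  by elim: ga g => //= c ga IH g; rewrite -IH DsC.
move=> ab; rewrite !mcE; congr (sf_eps S _).
apply: (catCA_perm_ind (P := fun ga => Ds al f = Ds ga f)) ab _ => // s1 s2 s3 ->.
by rewrite /Ds !foldl_cat -!/(Ds _ _) (DsCs s2).
Qed.

Lemma coef_seq_part al f : exists2 nu, is_part nu & mc al f = mc nu f /\ sumn nu = sumn al.
Proof.
exists (sort geq [seq e <- al | e != 0%N]).
  rewrite /is_part mem_sort mem_filter eqxx andbT.
  by apply: sort_sorted => x y; apply: leq_total.
have pf : perm_eq al ([seq e <- al | e != 0%N] ++ nseq (count (pred1 0%N) al) 0%N).
  have -> : nseq (count (pred1 0%N) al) 0%N = [seq e <- al | predC (fun e => e != 0%N) e].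
    rewrite -size_filter; apply/esym.
    rewrite (eq_filter (a2 := pred1 0%N)) => [|e]; last by rewrite /= negbK.
    by apply/all_pred1P; apply: filter_all.
  by rewrite perm_sym; apply/permPl/perm_filterC.
split.
  rewrite (coef_seq_perm f pf) coef_seq_cat0; apply: coef_seq_perm.
  by rewrite perm_sym perm_sort.
rewrite (perm_sumn pf) sumn_cat sumn_nseq mul0n addn0.
by apply: perm_sumn; rewrite perm_sort.
Qed.

Lemma coef_seq_bounded f : exists b, forall al, mc al f != 0 -> (sumn al <= b)%N.
Proof.
suff [b H] : exists b, forall al, (b < sumn al)%N -> mc al f = 0.
  by exists b => al; apply: contraNT; rewrite -ltnNge => /H ->.
elim/(@sf_ind _ _ S): f => [|f g [b1 H1] [b2 H2]|c f [b H]|i f [b H]].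
- exists 0%N; elim=> [|a al IH] //= h; rewrite sf_skew1; case: eqP h => [->|_ _] /=.
    exact: IH.
  exact: coef_seq0.
- exists (maxn b1 b2) => al h; rewrite coef_seqD H1 ?H2 ?addr0 //; lia.
- by exists b => al h; rewrite coef_seqZ H ?mulr0.
exists (b + i.+1)%N => al h.
have G : forall al f b c, (forall al, (b < c + sumn al)%N -> mc al f = 0) ->
    (b + i.+1 < c + sumn al)%N -> mc al (p i * f) = 0.
  elim=> [|a be IH] f' b' c Hf /= hb; first exact: sf_eps_p.
  rewrite sf_skew_p coef_seqD (IH _ b' (c + a)%N) ?add0r; last 2 first.
  - by move=> ga hg; apply: (Hf (a :: ga)) => /=; lia.
  - by lia.
  case: ltnP => ia; last exact: coef_seq0.
  by apply: (Hf (a - i.+1 :: be)%N) => /=; lia.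
by apply: (G al f b 0%N); rewrite ?add0n.
Qed.

Variable P : seq nat -> A.
Hypothesis P_dom : forall la al, is_part la -> mc al (P la) != 0 -> dom al la.
Hypothesis P_lead : forall la, is_part la -> mc la (P la) = 1.
Hypothesis P_orth : forall la mu, is_part la -> is_part mu -> la != mu -> B (P la) (P mu) = 0.

Lemma sum_neq0_ex (I : eqType) (r : seq I) (Pr : pred I) (F : I -> K) :
  \sum_(i <- r | Pr i) F i != 0 -> exists2 i, (i \in r) && Pr i & F i != 0.
Proof.
elim: r => [|i r IH]; first by rewrite big_nil eqxx.
rewrite big_cons; case: ifP => Pi.
  have [->|Fi _] := eqVneq (F i) 0; last by exists i; rewrite // mem_head.
  by rewrite add0r => /IH[j /andP[jr Pj] Fj]; exists j => //; rewrite inE jr orbT.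
by case/IH=> j /andP[jr Pj] Fj; exists j => //; rewrite inE jr orbT.
Qed.

Let expansion (Q : seq nat -> Prop) (b : nat) f :=
  exists c : seq nat -> K, (forall la, c la != 0 -> Q la) /\
    f = \sum_(la <- parts_upto b) c la *: P la.

Lemma P_expansion (Q : seq nat -> Prop) b f :
  (forall nu la, is_part nu -> is_part la -> dom nu la -> Q la -> Q nu) ->
  (forall al, mc al f != 0 -> (sumn al <= b)%N) ->
  (forall nu, is_part nu -> mc nu f != 0 -> Q nu) -> expansion Q b f.
Proof.
move=> Qdown fb fQ.
have fr nu : is_part nu -> mc nu f != 0 -> (dom_rank b nu < (b.+1 * b).+1)%N.
  by move=> _ /fb; rewrite ltnS; apply: dom_rank_bound.
move: (_.+1) fr => n; elim: n f fb fQ => [|n IH] f fb fQ fr.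
  exists (fun=> 0); split=> [la|]; first by rewrite eqxx.
  rewrite big1 => [|la _]; last by rewrite scale0r.
  apply: sf_coef_inj => al; have [nu pn [-> _]] := coef_seq_part al f.
  by apply/eqP/negPn/negP => /(fr _ pn).
pose f' := f - \sum_(mu <- parts_upto b | dom_rank b mu == n) mc mu f *: P mu.
have mcf' al : mc al f' = mc al f -
    \sum_(mu <- parts_upto b | dom_rank b mu == n) mc mu f * mc al (P mu).
  rewrite coef_seqB coef_seq_sum; congr (_ - _); apply: eq_bigr => mu _.
  exact: coef_seqZ.
have mcf'_neq0 al : mc al f' != 0 -> mc al f != 0 \/
    exists mu, [/\ is_part mu, mc mu f != 0, dom_rank b mu = n & dom al mu].
  rewrite mcf'; have [->|] := eqVneq (mc al f) 0; last by left.
  rewrite sub0r oppr_eq0 => /sum_neq0_ex[mu /andP[/parts_upto_part pm /eqP rm]].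
  rewrite mulf_eq0 negb_or => /andP[m0 /(P_dom pm) dm]; right.
  by exists mu.
have fb' al : mc al f' != 0 -> (sumn al <= b)%N.
  by case/mcf'_neq0 => [/fb//|[mu [_ /fb mb _ [-> _]]]].
have [||c [cQ fE]] := IH f' fb'.
- move=> nu pn /mcf'_neq0[/(fQ _ pn)//|[mu [pm /(fQ _ pm) Qm _ dm]]].
  exact: Qdown dm Qm.
- move=> nu pn f'0; have nb := fb' _ f'0; rewrite ltn_neqAle; apply/andP; split; last first.
    case/mcf'_neq0: f'0 => [/(fr _ pn)//|[mu [_ _ <- dm]]].
    exact: dom_rank_le.
  apply: contraNneq f'0 => rn; rewrite mcf' -big_filter (bigD1_seq nu) /=; last 2 first.
  - by rewrite mem_filter rn eqxx mem_parts_upto.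
  - by rewrite filter_uniq // undup_uniq.
  rewrite P_lead // mulr1 big1_seq ?addr0 ?subrr // => mu /andP[mn].
  rewrite mem_filter => /andP[/eqP rm /parts_upto_part pm]; apply/eqP.
  rewrite mulf_eq0; apply/orP; right; apply: contraNT mn => /(P_dom pm) dm.
  by apply/eqP/esym/(dom_rank_eq pn pm nb dm); rewrite rn rm.
exists (fun mu => c mu + if is_part mu && (dom_rank b mu == n) then mc mu f else 0).
split=> [mu|].
  have [->|/cQ//] := eqVneq (c mu) 0; rewrite add0r; case: ifP => [/andP[pm _]|_].
    exact: fQ.
  by rewrite eqxx.
rewrite -[LHS](subrK (\sum_(mu <- parts_upto b | dom_rank b mu == n) mc mu f *: P mu)) -/f' fE.
rewrite [X in _ + X]big_mkcond -big_split /=; apply: eq_big_seq => mu /parts_upto_part ->.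
by rewrite scalerDl /=; case: ifP => _; rewrite ?scale0r.
Qed.

Local Notation N la := (B (P la) (P la)).

Lemma pair_P_expansion (c : seq nat -> K) b mu : is_part mu ->
  B (\sum_(la <- parts_upto b) c la *: P la) (P mu) =
    if mu \in parts_upto b then c mu * N mu else 0.
Proof.
move=> pm; rewrite pair_suml; case: ifP => mb.
  rewrite (bigD1_seq mu) ?undup_uniq //= sf_pairZl big1_seq ?addr0 // => la /andP[lm lb].
  by rewrite sf_pairZl P_orth ?mulr0 // (parts_upto_part lb).
rewrite big1_seq // => la /= lb; rewrite sf_pairZl P_orth ?mulr0 ?(parts_upto_part lb) //.
by apply: contraFneq mb => <-.
Qed.

Lemma P_expansionT f b0 : exists b c, (b0 <= b)%N /\
  f = \sum_(la <- parts_upto b) c la *: P la.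
Proof.
have [b fb] := coef_seq_bounded f; exists (maxn b0 b).
have [//||//|c [_ fE]] := @P_expansion (fun=> True) (maxn b0 b) f.
  by move=> al /fb; lia.
by exists c; split=> //; apply: leq_maxl.
Qed.

Lemma P_norm_neq0 la : is_part la -> N la != 0.
Proof.
move=> pl; apply/eqP => N0.
have P0 : P la = 0.
  apply: sf_pair_inj => g; have [b [c [_ ->]]] := P_expansionT g 0.
  by rewrite sf_pairC pair_P_expansion // N0 mulr0 if_same.
by have := P_lead pl; rewrite P0 coef_seq0 => /eqP; rewrite eq_sym oner_eq0.
Qed.

Lemma pair_P_support (Q : seq nat -> Prop) f mu :
  (forall nu la, is_part nu -> is_part la -> dom nu la -> Q la -> Q nu) ->
  (forall nu, is_part nu -> mc nu f != 0 -> Q nu) ->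
  is_part mu -> B f (P mu) != 0 -> Q mu.
Proof.
move=> Qdown fQ pm; have [b fb] := coef_seq_bounded f.
have [c [cQ ->]] := P_expansion Qdown fb fQ.
rewrite pair_P_expansion //; case: ifP => _; last by rewrite eqxx.
by rewrite mulf_eq0 negb_or => /andP[/cQ].
Qed.

Lemma pair_P_lead f mu : is_part mu ->
  (forall nu, is_part nu -> mc nu f != 0 -> dom nu mu) -> B f (P mu) = mc mu f * N mu.
Proof.
move=> pm fd; have [b0 fb0] := coef_seq_bounded f; pose b := maxn b0 (sumn mu).
have fb al : mc al f != 0 -> (sumn al <= b)%N by move/fb0; rewrite /b; lia.
have [nu la _ _|c [cQ fE]] := @P_expansion (fun nu => dom nu mu) b f _ fb fd.
  exact: dom_trans.
have mb : mu \in parts_upto b by rewrite mem_parts_upto // /b leq_maxr.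
rewrite fE pair_P_expansion // mb; congr (_ * _).
rewrite coef_seq_sum (bigD1_seq mu) ?undup_uniq //= coef_seqZ P_lead // mulr1.
rewrite big1_seq ?addr0 // => la /andP[lm /parts_upto_part pl].
rewrite coef_seqZ; apply/eqP; rewrite mulf_eq0; apply: contraNT lm.
rewrite negb_or => /andP[/cQ d1 /(P_dom pl) d2].
by apply/eqP/dom_antisym.
Qed.

Section Functional.

Variable phi : A -> K.
Hypothesis phiD : forall f g, phi (f + g) = phi f + phi g.
Hypothesis phiZ : forall a f, phi (a *: f) = a * phi f.

Lemma functional_P_eq0 f :
  (forall la, is_part la -> B f (P la) * phi (P la) = 0) -> phi f = 0.
Proof.
move=> fg; have [b [c [_ fE]]] := P_expansionT f 0.
have phi0 : phi 0 = 0 by rewrite -(scale0r 0) phiZ mul0r.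
rewrite fE (big_morph phi phiD phi0) big1_seq // => la /= lb; have pl := parts_upto_part lb.
have /eqP := fg la pl; rewrite fE pair_P_expansion // lb phiZ.
by rewrite mulrAC mulf_eq0 (negPf (P_norm_neq0 pl)) orbF => /eqP.
Qed.

Lemma functional_P_single f mu : is_part mu ->
  (forall la, is_part la -> la != mu -> B f (P la) * phi (P la) = 0) ->
  phi f = B f (P mu) * phi (P mu) / N mu.
Proof.
move=> pm fg; pose f' := f - (B f (P mu) / N mu) *: P mu.
have nm := P_norm_neq0 pm.
have : phi f' = 0.
  apply: functional_P_eq0 => la pl; rewrite /f' sf_pairDl -scaleNr sf_pairZl.
  have [->|lm] := eqVneq la mu; first by rewrite mulNr divfK // subrr mul0r.
  have o : B (P mu) (P la) = 0 by apply: P_orth => //; rewrite eq_sym.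
  by rewrite o mulr0 addr0 fg.
rewrite /f' phiD -scaleNr phiZ => /eqP.
by rewrite mulNr subr_eq0 => /eqP ->; rewrite mulrAC.
Qed.

End Functional.

Lemma P_expansion_pair f b0 : exists b, (b0 <= b)%N /\
  f = \sum_(la <- parts_upto b) (B f (P la) / N la) *: P la.
Proof.
have [b [c [bb fE]]] := P_expansionT f b0; exists b; split=> //; rewrite {1}fE.
apply: eq_big_seq => la lb; have pl := parts_upto_part lb.
by rewrite fE pair_P_expansion // lb mulfK ?P_norm_neq0.
Qed.

End MacdonaldBasis.

(** * Extremal Pieri coefficients *)

Section FirstColumn.

Local Open Scope nat_scope.

Definition add_column l (ta : seq nat) := map succn (ta ++ nseq (l - size ta) 0).
Definition remove_column (la : seq nat) := [seq x.-1 | x <- la & 1 < x].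

Lemma size_add_column l ta : size ta <= l -> size (add_column l ta) = l.
Proof. by move=> tl; rewrite size_map size_cat size_nseq subnKC. Qed.

Lemma sumn_take_add_column l ta j : size ta <= l ->
  sumn (take j (add_column l ta)) = minn j l + sumn (take j ta).
Proof.
move=> tl; elim: j => [|j IH]; first by rewrite !take0 min0n.
rewrite !sumn_takeS IH; have [jl|lj] := ltnP j l.
  rewrite (nth_map 0) ?size_cat ?size_nseq ?subnKC // nth_cat.
  case: ltnP => jt; last by rewrite nth_nseq if_same [nth 0 ta j]nth_default //; lia.
  by lia.
rewrite nth_default ?size_add_column // [nth 0 ta j]nth_default; last by apply: leq_trans lj.
by lia.
Qed.

Lemma sumn_add_column l ta : size ta <= l -> sumn (add_column l ta) = l + sumn ta.
Proof.
move=> tl; have := sumn_take_add_column l tl.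
by rewrite !take_oversize ?size_add_column // minnn.
Qed.

Lemma is_part_add_column l ta : is_part ta -> size ta <= l -> is_part (add_column l ta).
Proof.
move=> pt tl; rewrite /is_part; apply/andP; split; last by apply/mapP => -[].
have tr : transitive geq by move=> a b c; rewrite /geq /= => h1 h2; apply: leq_trans h2 h1.
rewrite sorted_map sorted_pairwise // pairwise_cat; apply/and3P; split.
- by apply/allrelP => x y _; rewrite mem_nseq => /andP[_ /eqP ->].
- by rewrite -sorted_pairwise //; case/andP: pt.
elim: (l - size ta) => //= n ->; rewrite andbT; apply/allP => x.
by rewrite mem_nseq => /andP[_ /eqP ->].
Qed.

Lemma is_part_behead la : is_part la -> is_part (behead la).
Proof. by case: la => //= m ka; rewrite is_part_cons => /and3P[]. Qed.

Lemma is_part_remove_column la : is_part la -> is_part (remove_column la).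
Proof.
move=> /andP[sl _]; rewrite /is_part; apply/andP; split; last first.
  by apply/mapP => -[x]; rewrite mem_filter => /andP[x1 _]; lia.
have tr : transitive geq by move=> a b c; rewrite /geq /= => h1 h2; apply: leq_trans h2 h1.
apply: (homo_sorted (e := geq)); first by move=> x y; rewrite /geq /=; lia.
exact: sorted_filter.
Qed.

Lemma size_remove_column la : size (remove_column la) <= size la.
Proof. by rewrite size_map size_filter count_size. Qed.

Lemma remove_column_nil la : is_part la -> head 0 la <= 1 -> remove_column la = [::].
Proof.
elim: la => //= m ka IH; rewrite is_part_cons => /and3P[m0 km pk] m1.
by rewrite /remove_column /= ltnNge m1; apply: IH => //; apply: leq_trans m1.
Qed.

Lemma add_remove_column mu : is_part mu -> add_column (size mu) (remove_column mu) = mu.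
Proof.
elim: mu => //= m ka IH; rewrite is_part_cons => /and3P[m0 km pk].
case: (ltnP 1 m) => m1; rewrite /remove_column /= ?m1.
  by rewrite /add_column /= subSS prednK // -/(remove_column ka) -[in RHS](IH pk).
have m1E : m = 1 by lia.
rewrite ltnNge m1 /= -/(remove_column ka) -[in RHS](IH pk) remove_column_nil //; last by lia.
by rewrite /add_column /= !subn0 m1E.
Qed.

Lemma is_part_full_take la j : is_part la -> sumn la <= sumn (take j la) -> size la <= j.
Proof.
move=> pl lj; rewrite leqNgt; apply/negP => jl.
have := sumn_take_le j.+1 la; rewrite sumn_takeS.
by have := is_part_nth_gt0 j pl; rewrite jl; lia.
Qed.

Lemma remove_column_cons m ka : is_part (m :: ka) ->
  remove_column (m :: ka) = if 1 < m then m.-1 :: remove_column ka else [::].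
Proof.
move=> pl; case: ifP => m1; first by rewrite /remove_column /= m1.
by apply: remove_column_nil => //=; rewrite leqNgt m1.
Qed.

Lemma head_behead_part m (la : seq nat) : is_part la -> head 0 la = m -> 0 < m ->
  la = m :: behead la.
Proof. by case: la => [|k ka] /= _ <-. Qed.

Lemma head0_part (la : seq nat) : is_part la -> head 0 la = 0 -> la = [::].
Proof.
by case: la => [|k ka] //=; rewrite is_part_cons => /and3P[k0 _ _] k0'; rewrite k0' in k0.
Qed.

Lemma sumn0_part la : is_part la -> sumn la = 0 -> la = [::].
Proof. by case: la => // a la; rewrite is_part_cons /= => /and3P[a0 _ _]; lia. Qed.

Lemma dom_size nu mu : is_part mu -> dom nu mu -> size mu <= size nu.
Proof.
by move=> pm [h1 h2]; apply: is_part_full_take => //; rewrite -h1 -{1}(take_size nu); apply: h2.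
Qed.

Lemma sumn_take_behead j (la : seq nat) :
  sumn (take j.+1 la) = head 0 la + sumn (take j (behead la)).
Proof. by case: la => [|k ka]. Qed.

Lemma is_part_head_behead la mu : is_part la -> is_part mu ->
  head 0 la = head 0 mu -> behead la = behead mu -> la = mu.
Proof.
case: la => [|k ka]; first by move=> _ pm /esym h _; rewrite (head0_part pm h).
case: mu => [|l mu]; first by move=> pl _ h _; rewrite (head0_part pl h).
by move=> _ _ /= -> ->.
Qed.

Lemma count_remove_column j la :
  count (fun r => j < r) (remove_column la) = count (fun r => j.+1 < r) la.
Proof.
rewrite /remove_column count_map count_filter; apply: eq_count => r /=.
by lia.
Qed.

Lemma behead_remove_column la : is_part la ->
  behead (remove_column la) = remove_column (behead la).
Proof.
case: la => // m ka pl; rewrite remove_column_cons //=; case: ifP => //= m1.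
rewrite remove_column_nil ?(is_part_behead pl) //; move: pl; rewrite is_part_cons.
by move=> /and3P[_ h _]; apply: leq_trans h _; rewrite leqNgt m1.
Qed.

End FirstColumn.

Section PieriExtremal.

Variables (K : fieldType) (q t : K).
Hypothesis charK : [pchar K] =i pred0.
Hypothesis generic : forall a b, (0 < a + b)%N -> q ^+ a * t ^+ b != 1.

Let w k : K := (1 - q ^+ k) / (1 - t ^+ k).
Variable S : symfun_theory w.

Local Notation A := (sf_alg S).
Local Notation p := (sf_p S).
Local Notation D := (sf_skew S).
Local Notation B := (@sf_pair _ _ S).
Local Notation mc := (coef_seq (@sf_eps _ _ S) D).
Implicit Types (f g h : A) (la mu nu ta rho : seq nat).

Variables (E G : nat -> A) (P : seq nat -> A).
Hypothesis newtonE : newton p (fun=> -1) E.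
Hypothesis newtonG : newton p (fun k => (1 - t ^+ k) / (1 - q ^+ k)) G.
Hypothesis P_dom : forall la al, is_part la -> mc al (P la) != 0 -> dom al la.
Hypothesis P_lead : forall la, is_part la -> mc la (P la) = 1.
Hypothesis P_orth : forall la mu, is_part la -> is_part mu -> la != mu -> B (P la) (P mu) = 0.

Local Notation N la := (B (P la) (P la)).

Let N_neq0 la : is_part la -> N la != 0 := P_norm_neq0 P_dom P_lead P_orth (la := la).

Definition row_pieri k la si := B (P la) (G k * P si).
Definition col_pieri l la ta := B (P la) (E l * P ta).
Definition row_col_pieri k l la ta := B (P la) (G k * (E l * P ta)).

Lemma one_sub_exp_neq0 a b : (0 < a + b)%N -> 1 - q ^+ a * t ^+ b != 0.
Proof. by move=> ab; rewrite subr_eq0 eq_sym generic. Qed.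

Lemma one_subq_neq0 k : 1 - q ^+ k.+1 != 0.
Proof. by have := @one_sub_exp_neq0 k.+1 0; rewrite addn0 expr0 mulr1; apply. Qed.

Lemma one_subt_neq0 k : 1 - t ^+ k.+1 != 0.
Proof. by have := @one_sub_exp_neq0 0 k.+1; rewrite add0n expr0 mul1r; apply. Qed.

Lemma row_pieri_skew k f h : B f (G k * h) = B (D k f) h.
Proof.
have cw i : (1 - t ^+ i.+1) / (1 - q ^+ i.+1) * w i.+1 = 1.
  have := one_subq_neq0 i; have := one_subt_neq0 i; rewrite /w.
  by move: (1 - q ^+ _) (1 - t ^+ _) => x y y0 x0; rewrite mulrA mulfVK // divff.
rewrite [LHS]sf_pairC [RHS]sf_pairC.
exact: (pair_skew charK k h f cw newtonG).
Qed.

Lemma row_pieri_support k la si : is_part la -> is_part si ->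
  row_pieri k la si != 0 -> dom (k :: si) la.
Proof.
move=> pl ps; rewrite /row_pieri row_pieri_skew.
apply: (pair_P_support P_dom P_lead P_orth (Q := fun si => dom (k :: si) la)) => //.
  move=> nu mu _ _ [h1 h2]; apply: dom_trans; split=> [|[|j]] //=; first by rewrite h1.
  by rewrite leq_add2l.
by move=> nu _ h; apply: P_dom.
Qed.

Lemma row_pieri_lead k si : is_part si -> is_part (k :: si) ->
  row_pieri k (k :: si) si = N si.
Proof.
move=> ps pks; rewrite /row_pieri row_pieri_skew (pair_P_lead P_dom P_lead P_orth) //.
  have -> : mc si (D k (P (k :: si))) = 1 := P_lead pks.
  by rewrite mul1r.
move=> nu _ /(P_dom (al := k :: nu) pks) [h1 h2]; split.
  by move: h1 => /= /addnI.
by move=> j; have := h2 j.+1; rewrite /= leq_add2l.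
Qed.

Lemma row_pieri_0 la : is_part la -> row_pieri 0 la la = N la.
Proof. by rewrite /row_pieri newtonG.1 mul1r. Qed.

Lemma col_pieri_support l la ta : is_part la -> is_part ta ->
  col_pieri l la ta != 0 -> sumn la = (l + sumn ta)%N /\
    forall j, (sumn (take j la) <= minn j l + sumn (take j ta))%N.
Proof.
move=> pl pt; rewrite /col_pieri sf_pairC.
apply: (pair_P_support P_dom P_lead P_orth (Q := fun la =>
    sumn la = (l + sumn ta)%N /\
    forall j, (sumn (take j la) <= minn j l + sumn (take j ta))%N)) => //.
  move=> nu mu _ _ [h1 h2] [h3 h4]; split=> [|j]; first by rewrite h1.
  exact: leq_trans (h2 j) (h4 j).
move=> nu _ /(coef_elemM_neq0 charK newtonE)[be [/(P_dom pt)[b1 b2] b3 b4]].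
split=> [|j]; first by rewrite b3 b1.
by apply: leq_trans (b4 j) _; rewrite leq_add2l.
Qed.

Lemma col_pieri_lead l ta : is_part ta -> (size ta <= l)%N ->
  col_pieri l (add_column l ta) ta = (-1) ^+ l * N (add_column l ta).
Proof.
move=> pt tl; have pa := is_part_add_column pt tl.
rewrite /col_pieri sf_pairC (pair_P_lead P_dom P_lead P_orth) //.
  congr (_ * _); have sE : l = size (ta ++ nseq (l - size ta) 0%N).
    by rewrite size_cat size_nseq subnKC.
  rewrite {2}sE (coef_elemM_col charK newtonE) -sE coef_seq_cat0.
  by rewrite P_lead // mulr1.
move=> nu _ /(coef_elemM_neq0 charK newtonE)[be [/(P_dom pt)[b1 b2] b3 b4]].
split=> [|j]; first by rewrite b3 b1 sumn_add_column.
by rewrite sumn_take_add_column //; apply: leq_trans (b4 j) _; rewrite leq_add2l.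
Qed.

Lemma row_col_pieri_eq0 k l la ta :
  (forall nu, is_part nu -> col_pieri l nu ta * row_pieri k la nu = 0) ->
  row_col_pieri k l la ta = 0.
Proof.
move=> h; apply: (functional_P_eq0 P_dom P_lead P_orth (phi := fun f => B (P la) (G k * f))).
- by move=> f g; rewrite mulrDr pairDr.
- by move=> a f; rewrite -scalerAr pairZr.
by move=> nu pn; rewrite [B _ (P nu)]sf_pairC; apply: h.
Qed.

Lemma row_col_pieri_single k l la ta mu : is_part mu ->
  (forall nu, is_part nu -> nu != mu -> col_pieri l nu ta * row_pieri k la nu = 0) ->
  row_col_pieri k l la ta = col_pieri l mu ta * row_pieri k la mu / N mu.
Proof.
move=> pm h; rewrite /col_pieri [B (P mu) (_ * _)]sf_pairC.
apply: (functional_P_single P_dom P_lead P_orth (phi := fun f => B (P la) (G k * f))) => //.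
- by move=> f g; rewrite mulrDr pairDr.
- by move=> a f; rewrite -scalerAr pairZr.
by move=> nu pn nm; rewrite [B _ (P nu)]sf_pairC; apply: h.
Qed.

Lemma row_col_pieri_eq0' k l la ta :
  (forall nu, is_part nu -> row_pieri k nu ta * col_pieri l la nu = 0) ->
  row_col_pieri k l la ta = 0.
Proof.
move=> h; rewrite /row_col_pieri mulrCA.
apply: (functional_P_eq0 P_dom P_lead P_orth (phi := fun f => B (P la) (E l * f))).
- by move=> f g; rewrite mulrDr pairDr.
- by move=> a f; rewrite -scalerAr pairZr.
by move=> nu pn; rewrite [B _ (P nu)]sf_pairC; apply: h.
Qed.

Lemma row_col_pieri_single' k l la ta mu : is_part mu ->
  (forall nu, is_part nu -> nu != mu -> row_pieri k nu ta * col_pieri l la nu = 0) ->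
  row_col_pieri k l la ta = row_pieri k mu ta * col_pieri l la mu / N mu.
Proof.
move=> pm h; rewrite /row_col_pieri /row_pieri [B (P mu) (_ * _)]sf_pairC mulrCA.
apply: (functional_P_single P_dom P_lead P_orth (phi := fun f => B (P la) (E l * f))) => //.
- by move=> f g; rewrite mulrDr pairDr.
- by move=> a f; rewrite -scalerAr pairZr.
by move=> nu pn nm; rewrite [B _ (P nu)]sf_pairC; apply: h.
Qed.

Lemma row_col_pieri_relation n la ta :
  \sum_(i < n.+1) (q ^+ i * t ^+ (n - i) - 1) * row_col_pieri i (n - i) la ta = 0.
Proof.
have := complete_elem_relation charK newtonE n one_subq_neq0 newtonG.
move/(congr1 (fun f => B (P la) (f * P ta))); rewrite mul0r pair0r mulr_suml pair_sumr.
by move=> h; rewrite -[RHS]h; apply: eq_bigr => i _; rewrite -scalerAl pairZr -mulrA.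
Qed.

Lemma row_pieri_big k la mu : is_part la -> is_part mu -> (head 0%N la < k)%N ->
  row_pieri k la mu = 0.
Proof.
move=> pl pm lk; apply/eqP/negPn/negP => /(row_pieri_support pl pm)[_ /(_ 1%N)].
by case: la lk {pl} => [|m ka] /=; rewrite !take0 /=; lia.
Qed.

Lemma col_pieri_big l la ta : is_part la -> is_part ta -> (size la < l)%N ->
  col_pieri l la ta = 0.
Proof.
move=> pl pt lk; apply/eqP/negPn/negP => /(col_pieri_support pl pt)[h /(_ (size la))].
by rewrite take_size h; have := sumn_take_le (size la) ta; lia.
Qed.

Lemma row_col_pieri_bigk k l la ta : is_part la -> (head 0%N la < k)%N ->
  row_col_pieri k l la ta = 0.
Proof.
by move=> pl lk; apply: row_col_pieri_eq0 => nu pn; rewrite row_pieri_big ?mulr0.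
Qed.

Lemma row_col_pieri_bigl k l la ta : is_part la -> (size la < l)%N ->
  row_col_pieri k l la ta = 0.
Proof.
by move=> pl ll; apply: row_col_pieri_eq0' => nu pn; rewrite col_pieri_big ?mulr0.
Qed.

Lemma row_col_pieri_extreme k l la ta : is_part la -> (0 < k + l)%N ->
  (head 0%N la <= k)%N -> (size la <= l)%N -> row_col_pieri k l la ta = 0.
Proof.
move=> pl kl lk ll; have := row_col_pieri_relation (k + l) la ta.
have kn : (k < (k + l).+1)%N by lia.
rewrite (bigD1 (Ordinal kn)) //= addKn big1 ?addr0 => [|i].
  move/eqP; rewrite mulf_eq0 subr_eq0 (negPf (generic kl)) => /eqP; exact.
rewrite -val_eqE /= => ik; apply/eqP; rewrite mulf_eq0; apply/orP; right; apply/eqP.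
have [ki|ki] := ltnP k i; first by apply: row_col_pieri_bigk => //; lia.
by apply: row_col_pieri_bigl => //; lia.
Qed.

Lemma row_col_pieri_corner m l la ta : is_part la ->
  head 0%N la = m.+1 -> size la = l.+1 ->
  (q ^+ m.+1 * t ^+ l - 1) * row_col_pieri m.+1 l la ta +
  (q ^+ m * t ^+ l.+1 - 1) * row_col_pieri m l.+1 la ta = 0.
Proof.
move=> pl lm ll; have := row_col_pieri_relation (m.+1 + l) la ta.
have kn : (m.+1 < (m.+1 + l).+1)%N by lia.
have kn' : (m < (m.+1 + l).+1)%N by lia.
rewrite (bigD1 (Ordinal kn)) //= (bigD1 (Ordinal kn')) /=; last by rewrite -val_eqE /=; lia.
rewrite addKn (_ : (m.+1 + l - m = l.+1)%N); last by lia.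
rewrite big1 ?addr0 // => i; rewrite -!val_eqE /= => /andP[im im'].
apply/eqP; rewrite mulf_eq0; apply/orP; right; apply/eqP.
have [ki|ki] := ltnP m i; first by apply: row_col_pieri_bigk => //; lia.
by apply: row_col_pieri_bigl => //; lia.
Qed.

Lemma col_pieri_dom l nu ta : is_part nu -> is_part ta -> (size ta <= l)%N ->
  col_pieri l nu ta != 0 -> dom nu (add_column l ta).
Proof.
move=> pn pt tl /(col_pieri_support pn pt)[h1 h2].
by split=> [|j]; rewrite ?sumn_add_column ?sumn_take_add_column.
Qed.

Lemma col_pieri_remove mu : is_part mu ->
  col_pieri (size mu) mu (remove_column mu) = (-1) ^+ size mu * N mu.
Proof.
move=> pm; rewrite -{2}(add_remove_column pm) col_pieri_lead ?add_remove_column //.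
  exact: is_part_remove_column.
exact: size_remove_column.
Qed.

Lemma row_pieri_behead rho : is_part rho ->
  row_pieri (head 0%N rho) rho (behead rho) = N (behead rho).
Proof.
case: rho => [|r si] pr; first exact: row_pieri_0.
exact: row_pieri_lead (is_part_behead pr) pr.
Qed.

Lemma row_pieri_long m la mu : is_part la -> is_part mu -> head 0%N la = m.+1 ->
  (size la <= size mu)%N -> row_pieri m.+1 la mu = 0.
Proof.
move=> pl pm lm lsm; have [b mb] : exists b, (sumn mu <= b)%N by exists (sumn mu).
have [n rn] := ubnP (dom_rank b mu).
elim: n mu pm lsm mb rn => // n IH mu pm lsm mb rn.
have nm := N_neq0 pm.
have pr := is_part_remove_column pm; have sr := size_remove_column mu.
have := @row_col_pieri_extreme m.+1 (size mu) la (remove_column mu) pl isT.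
rewrite lm leqnn lsm => /(_ isT isT).
rewrite (row_col_pieri_single pm) => [|nu pn nmu].
  rewrite col_pieri_remove // mulrAC mulfK // => /eqP; rewrite mulf_eq0 signr_eq0.
  by move/eqP.
have [->|/(col_pieri_dom pn pr sr)] := eqVneq (col_pieri (size mu) nu (remove_column mu)) 0.
  by rewrite mul0r.
rewrite add_remove_column // => dm; have [h _] := dm.
rewrite IH ?mulr0 ?h //; first by apply: leq_trans lsm (dom_size pm dm).
have := dom_rank_le b dm; rewrite leq_eqVlt => /orP[/eqP e|rl].
  by case/eqP: nmu; apply: (dom_rank_eq pn pm _ dm e); rewrite h.
exact: leq_trans rl rn.
Qed.

Lemma row_pieri_size m la mu : is_part la -> is_part mu -> head 0%N la = m.+1 ->
  row_pieri m.+1 la mu != 0 -> size la = (size mu).+1.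
Proof.
move=> pl pm lm nz; have [h1 h2] := row_pieri_support pl pm nz.
apply/eqP; rewrite eqn_leq; apply/andP; split.
  by apply: is_part_full_take => //; rewrite -h1 -[X in sumn X](take_size (m.+1 :: mu)); apply: h2.
by rewrite ltnNge; apply: contra nz => ls; rewrite row_pieri_long.
Qed.

Lemma col_pieri_wide m la rho : is_part la -> is_part rho -> head 0%N la = m.+1 ->
  (head 0%N la <= head 0%N rho)%N -> col_pieri (size la) la rho = 0.
Proof.
move=> pl pr lm lr; have [b rb] : exists b, sumn rho = b by exists (sumn rho).
have [n rn] := ubnP (b.+1 * b - dom_rank b rho)%N.
elim: n rho pr lr rb rn => // n IH rho pr lr rb rn.
have r0 : (0 < head 0%N rho)%N by rewrite (leq_trans _ lr) // lm.
have nr := N_neq0 pr; have pb := is_part_behead pr.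
have := @row_col_pieri_extreme (head 0%N rho) (size la) la (behead rho) pl.
rewrite addn_gt0 r0 lr leqnn => /(_ isT isT isT).
rewrite (row_col_pieri_single' pr) => [|nu pn nrho].
  rewrite row_pieri_behead // => /eqP; rewrite !mulf_eq0 invr_eq0 (negPf nr) orbF.
  by rewrite (negPf (N_neq0 pb)) => /eqP.
have [->|/(row_pieri_support pn pb) dm] := eqVneq (row_pieri (head 0%N rho) nu (behead rho)) 0.
  by rewrite mul0r.
rewrite -(head_behead_part pr erefl r0) in dm; have [h1 h2] := dm.
rewrite IH ?mulr0 -?h1 //.
  apply: leq_trans lr _; have := h2 1%N.
  by rewrite !sumn_take_behead !take0 !addn0.
have := dom_rank_le b dm; rewrite leq_eqVlt => /orP[/eqP e|rl].
  by case/eqP: nrho; apply/esym/(dom_rank_eq pr pn _ dm e); rewrite rb.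
have := dom_rank_bound (b := b) (la := nu); rewrite -h1 rb leqnn => /(_ isT).
by move: rn rl; lia.
Qed.

Lemma col_pieri_head m la rho : is_part la -> is_part rho -> head 0%N la = m.+1 ->
  col_pieri (size la) la rho != 0 -> head 0%N rho = m.
Proof.
move=> pl pr lm nz; have [_ /(_ 1%N)] := col_pieri_support pl pr nz.
rewrite !sumn_take_behead !take0 !addn0 lm => h; apply/eqP; rewrite eqn_leq.
apply/andP; split; last by have := geq_minl 1 (size la); lia.
rewrite -ltnS ltnNge; apply: contra nz => mr.
by rewrite (@col_pieri_wide m) // lm.
Qed.

Definition extremal la : Prop :=
  (forall mu, is_part mu -> row_pieri (head 0%N la) la mu != 0 -> mu = behead la) /\
  (forall rho, is_part rho -> col_pieri (size la) la rho != 0 -> rho = remove_column la).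

Lemma row_col_pieri_row m l la mu : is_part la -> head 0%N la = m.+1 -> size la = l.+1 ->
  (forall nu, is_part nu -> (sumn nu < sumn la)%N -> extremal nu) ->
  is_part mu -> size mu = l ->
  row_col_pieri m.+1 l la (remove_column mu) = (-1) ^+ l * row_pieri m.+1 la mu.
Proof.
move=> pl lm ls IH pm ms; rewrite (row_col_pieri_single pm) => [|nu pn nmu].
  by rewrite -[in col_pieri l]ms col_pieri_remove // ms mulrAC mulfK ?N_neq0.
have [->|rn] := eqVneq (row_pieri m.+1 la nu) 0; first by rewrite mulr0.
have sn : size nu = l by have := row_pieri_size pl pn lm rn; rewrite ls => -[].
have [h _] := row_pieri_support pl pn rn.
have nl : (sumn nu < sumn la)%N by rewrite -h /= addSn ltnS leq_addl.
have [_ eb] := IH nu pn nl.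
have [->|cn] := eqVneq (col_pieri l nu (remove_column mu)) 0; first by rewrite mul0r.
case/eqP: nmu; rewrite -(add_remove_column pn) -(add_remove_column pm) sn ms.
by rewrite (eb _ (is_part_remove_column pm)) // sn.
Qed.

Lemma row_col_pieri_col m l la rho : is_part la -> head 0%N la = m.+1 -> size la = l.+1 ->
  (forall nu, is_part nu -> (sumn nu < sumn la)%N -> extremal nu) ->
  is_part rho -> head 0%N rho = m ->
  row_col_pieri m l.+1 la (behead rho) = N (behead rho) * col_pieri l.+1 la rho / N rho.
Proof.
move=> pl lm ls IH pr rm; rewrite (row_col_pieri_single' pr) => [|nu pn nrho].
  by rewrite -{1}rm row_pieri_behead.
have [->|cn] := eqVneq (col_pieri l.+1 la nu) 0; first by rewrite mulr0.
have hn : head 0%N nu = m by apply: (col_pieri_head pl pn lm); rewrite ls.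
have [h _] := col_pieri_support pl pn cn.
have nl : (sumn nu < sumn la)%N by rewrite h addSn ltnS leq_addl.
have [ea _] := IH nu pn nl.
have [->|rn] := eqVneq (row_pieri m nu (behead rho)) 0; first by rewrite mul0r.
case/eqP: nrho; apply: is_part_head_behead; rewrite ?hn ?rm //.
by rewrite -(ea _ (is_part_behead pr)) // hn.
Qed.

Lemma corner_dom m l la nu rho : is_part la -> is_part nu -> is_part rho ->
  head 0%N la = m.+1 -> size la = l.+1 -> head 0%N rho = m -> size nu = l ->
  row_pieri m.+1 la nu != 0 -> col_pieri l.+1 la rho != 0 ->
  behead rho = remove_column nu -> nu = behead la.
Proof.
move=> pl pn pr lm ls rm sn rn cn e.
have [h1 h2] := row_pieri_support pl pn rn; have [_ h3] := col_pieri_support pl pr cn.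
apply: is_part_take_ext => //; first exact: is_part_behead.
move=> j; apply/eqP; rewrite eqn_leq; apply/andP; split.
  by have := h2 j.+1; rewrite [X in (_ <= X)%N]sumn_take_behead lm /= leq_add2l.
have := h3 j.+1; rewrite !sumn_take_behead lm rm e.
have sr := size_remove_column nu.
have := sumn_take_add_column j sr; rewrite add_remove_column // sn minnSS => ->.
by lia.
Qed.

Lemma extremalP la : is_part la -> extremal la.
Proof.
have [n] := ubnP (sumn la); elim: n la => // n IHn la ln pl.
have IH nu : is_part nu -> (sumn nu < sumn la)%N -> extremal nu.
  by move=> pn nl; apply: IHn => //; apply: leq_trans nl ln.
have [l0|[m lm]] : la = [::] \/ exists m, head 0%N la = m.+1.
- case: (la) pl => [|[|m] ka]; [by left | by rewrite is_part_cons | by right; exists m].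
- rewrite l0; split=> mu pm.
    by case/(@row_pieri_support 0 [::] mu isT pm) => /= h _; apply: sumn0_part; rewrite ?h.
  by case/(@col_pieri_support 0 [::] mu isT pm) => /= h _; apply: sumn0_part; rewrite -?h.
have [l ls] : exists l, size la = l.+1 by case: (la) lm => // k ka _; exists (size ka).
have q1 : q ^+ m.+1 * t ^+ l - 1 != 0 by rewrite subr_eq0 generic.
have q2 : q ^+ m * t ^+ l.+1 - 1 != 0 by rewrite subr_eq0 generic // addnS.
have corner ta : (row_col_pieri m.+1 l la ta == 0) = (row_col_pieri m l.+1 la ta == 0).
  have := @row_col_pieri_corner m l la ta pl lm ls; move: (row_col_pieri _ _ _ _) => x.
  move: (row_col_pieri _ _ _ _) => y /eqP; rewrite addr_eq0 => /eqP h.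
  by rewrite -(mulrI_eq0 _ (mulfI q1)) h oppr_eq0 (mulrI_eq0 _ (mulfI q2)).
split=> [mu pm|rho pr]; rewrite ?lm ?ls => nz.
  have sm : size mu = l by have := row_pieri_size pl pm lm nz; rewrite ls => -[].
  apply/eqP/negPn/negP => /eqP nmu; case/negP: (nz); have := corner (remove_column mu).
  rewrite (row_col_pieri_row pl lm ls IH pm sm) mulf_eq0 signr_eq0 /= => ->.
  apply/eqP/row_col_pieri_eq0' => rho pr; apply/eqP.
  have [->|cn] := eqVneq (col_pieri l.+1 la rho) 0; first by rewrite mulr0.
  have [->|rn] := eqVneq (row_pieri m rho (remove_column mu)) 0; first by rewrite mul0r.
  have rm : head 0%N rho = m by apply: (col_pieri_head pl pr lm); rewrite ls.
  have [h _] := col_pieri_support pl pr cn.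
  have rl : (sumn rho < sumn la)%N by rewrite h addSn ltnS leq_addl.
  have [ea _] := IH rho pr rl.
  case: nmu; apply: (corner_dom pl pm pr lm ls rm sm nz cn).
  by apply/esym/ea; rewrite ?rm //; apply: is_part_remove_column.
have rm : head 0%N rho = m by apply: (col_pieri_head pl pr lm); rewrite ls.
apply/eqP/negPn/negP => /eqP nrho; case/negP: (nz); have := corner (behead rho).
rewrite (row_col_pieri_col pl lm ls IH pr rm) !mulf_eq0 invr_eq0.
rewrite (negPf (N_neq0 pr)) (negPf (N_neq0 (is_part_behead pr))) orbF /= => <-.
apply/eqP/row_col_pieri_eq0 => nu pn; apply/eqP.
have [->|rn] := eqVneq (row_pieri m.+1 la nu) 0; first by rewrite mulr0.
have [->|cn] := eqVneq (col_pieri l nu (behead rho)) 0; first by rewrite mul0r.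
have sn : size nu = l by have := row_pieri_size pl pn lm rn; rewrite ls => -[].
have [h _] := row_pieri_support pl pn rn.
have nl : (sumn nu < sumn la)%N by rewrite -h /= addSn ltnS leq_addl.
have [_ eb] := IH nu pn nl.
have e : behead rho = remove_column nu by apply: eb; rewrite ?sn // is_part_behead.
case: nrho; apply: is_part_head_behead => //; first exact: is_part_remove_column.
  rewrite rm; case: (la) lm pl => [|k ka] //= -> pl'.
  by rewrite remove_column_cons //; case: (m).
by rewrite e (corner_dom pl pn pr lm ls rm sn rn nz e) behead_remove_column.
Qed.

Lemma norm_corner m ka : is_part (m.+1 :: ka) ->
  (1 - q ^+ m.+1 * t ^+ size ka) * N ka * N (remove_column (m.+1 :: ka)) =
  (1 - q ^+ m * t ^+ (size ka).+1) * N (remove_column ka) * N (m.+1 :: ka).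
Proof.
set la := _ :: _ => pl.
have lm : head 0%N la = m.+1 by []; have [l lE] : exists l, size ka = l by exists (size ka).
have ls : size la = l.+1 by rewrite -lE.
have pk : is_part ka := is_part_behead pl.
have pr := is_part_remove_column pl; have sr := size_remove_column la.
have IH nu : is_part nu -> (sumn nu < sumn la)%N -> extremal nu by move=> pn _; apply: extremalP.
have rm : head 0%N (remove_column la) = m by rewrite remove_column_cons //; case: (m).
have := @row_col_pieri_corner m l la (remove_column ka) pl lm ls.
rewrite (row_col_pieri_row pl lm ls IH pk lE).
have e : remove_column ka = behead (remove_column la) by rewrite behead_remove_column.
rewrite [in X in _ + X]e (row_col_pieri_col pl lm ls IH pr rm) -e.
have cE := col_pieri_remove pl; rewrite ls in cE.
rewrite (row_pieri_lead pk pl) cE lE [(-1) ^+ l.+1]exprS.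
have s1 : (-1) ^+ l != 0 :> K by rewrite signr_eq0.
have := N_neq0 pr; move: (N (remove_column la)) (N ka) (N la) (N (remove_column ka)).
move: (q ^+ m.+1 * _) (q ^+ m * _) ((-1) ^+ l) s1 => a b s s1 x y z u x0 h.
apply: (mulfI s1); apply/eqP; rewrite -subr_eq0; apply/eqP.
transitivity (- x * ((a - 1) * (s * y) + (b - 1) * (u * (-1 * s * z) / x))).
  by field.
by rewrite h mulr0.
Qed.

End PieriExtremal.

(** * Complete homogeneous functions *)

Section CompleteHomogeneous.

Variables (K : fieldType) (R : comNzRingType) (iota : {rmorphism K -> R}).
Hypothesis charK : [pchar K] =i pred0.

(* The image of h_n under the morphism p_(i+1) |-> y i. *)
Definition hsym_image (y : nat -> R) (n : nat) : R :=
  \sum_(a : {ffun 'I_n -> 'I_n.+1} | (\sum_(i < n) a i * i.+1 == n)%N)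
    iota (\prod_(i < n) ((a i)`! * i.+1 ^ a i))%N%:R^-1 * \prod_(i < n) y i ^+ a i.

Lemma hsym_image_polyX (y : nat -> R) n :
  \sum_(a : {ffun 'I_n -> 'I_n.+1} | (\sum_(i < n) a i * i.+1 == n)%N)
    (iota (\prod_(i < n) ((a i)`! * i.+1 ^ a i))%N%:R^-1)%:P *
      \prod_(i < n) ((y i)%:P * 'X^(i.+1)) ^+ a i = (hsym_image y n)%:P * 'X^n.
Proof.
rewrite /hsym_image rmorph_sum mulr_suml; apply: eq_bigr => a /eqP an.
rewrite rmorphM /= -mulrA; congr (_ * _); rewrite rmorph_prod.
under eq_bigr => i _ do rewrite exprMn -exprM mulnC.
rewrite big_split /= -expr_sum an; congr (_ * _).
by apply: eq_bigr => i _; rewrite rmorphXn.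
Qed.

Let expfac (y : nat -> R) N i : {poly R} :=
  \sum_(a < N.+1) (iota (a`! * i.+1 ^ a)%N%:R^-1)%:P * ((y i)%:P * 'X^(i.+1)) ^+ a.

Let natr_neq0 n : (0 < n)%N -> n%:R != 0 :> K.
Proof. by rewrite ((pcharf0P K).1 charK) lt0n. Qed.

Lemma expfac_deriv y N i k : (k < N)%N ->
  (expfac y N i)^`()`_k = (((y i)%:P * 'X^i) * expfac y N i)`_k.
Proof.
move=> kN; pose T a := (iota (a`! * i.+1 ^ a)%N%:R^-1)%:P * ((y i)%:P * 'X^(i.+1)) ^+ a.
have dE : (expfac y N i)^`() = (y i)%:P * 'X^i * \sum_(a < N) T a.
  rewrite /expfac big_ord_recl derivD raddf_sum /= mulr_sumr.
  have -> : (iota (0`! * i.+1 ^ 0)%N%:R^-1)%:P * ((y i)%:P * 'X^(i.+1)) ^+ 0 = 1.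
    by rewrite fact0 expn0 muln1 invr1 rmorph1 mul1r expr0.
  rewrite derivC add0r; apply: eq_bigr => a _; rewrite /bump /= add1n.
  rewrite derivM derivC mul0r add0r deriv_exp /= derivM derivC mul0r add0r.
  rewrite derivXn /= factS expnS.
  have -> : (a.+1 * a`! * (i.+1 * i.+1 ^ a))%N%:R^-1 =
     (a.+1%:R * i.+1%:R)^-1 * (a`! * i.+1 ^ a)%N%:R^-1 :> K.
    by rewrite -invfM -!natrM; congr (_%:R^-1); lia.
  have mn (z : {poly R}) n : z *+ n = n%:R * z := esym (mulr_natl z n).
  rewrite rmorphM polyCM [X in _ * X = _]mn ['X^i *+ _]mn.
  have c1 : (iota (a.+1%:R * i.+1%:R)^-1)%:P * (a.+1%:R * i.+1%:R) = 1 :> {poly R}.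
    rewrite -!polyC_natr -(rmorph_nat iota) -(rmorph_nat iota i.+1) -!polyCM -!rmorphM.
    rewrite mulVf; first by rewrite rmorph1 polyC1.
    exact: (natr_neq0 (n := a.+1 * i.+1)).
  transitivity ((iota (a.+1%:R * i.+1%:R)^-1)%:P * (a.+1%:R * i.+1%:R) *
     ((y i)%:P * 'X^i * T a)); last by rewrite c1 mul1r.
  by rewrite /T; ring.
have sE : expfac y N i = \sum_(a < N) T a + T N by rewrite /expfac big_ord_recr.
rewrite dE sE mulrDr coefD [X in _ = _ + X](_ : _ = 0) ?addr0 //.
have -> : (y i)%:P * 'X^i * T N =
    ((y i)%:P * (iota (N`! * i.+1 ^ N)%N%:R^-1)%:P * (y i)%:P ^+ N * 'X^i) * 'X^(i.+1 * N).
  by rewrite /T exprMn -exprM; ring.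
by rewrite coefMXn ifT //; nia.
Qed.

Let expprod y N := \prod_(i < N) expfac y N i.

Lemma expprod_deriv y N k : (k < N)%N ->
  (expprod y N)^`()`_k = ((\sum_(i < N) (y i)%:P * 'X^i) * expprod y N)`_k.
Proof.
rewrite /expprod; suff H M : (k < N)%N -> (\prod_(i < M) expfac y N i)^`()`_k =
    ((\sum_(i < M) (y i)%:P * 'X^i) * \prod_(i < M) expfac y N i)`_k by exact: H.
elim: M k => [|M IH] k kN.
  by rewrite !big_ord0 derivC mul0r.
rewrite !big_ord_recr /= derivM coefD.
set P := \prod_(i < M) _; set Q := \sum_(i < M) _.
have -> : (Q + (y M)%:P * 'X^M) * (P * expfac y N M) =
    Q * P * expfac y N M + P * ((y M)%:P * 'X^M * expfac y N M) by ring.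
rewrite coefD; congr (_ + _).
  rewrite !coefM; apply: eq_bigr => j _; congr (_ * _).
  apply: IH.
  by apply: leq_trans kN; rewrite ltnS -ltnS; apply: ltn_ord.
rewrite !coefM; apply: eq_bigr => j _; congr (_ * _).
by apply: expfac_deriv; apply: leq_ltn_trans kN; apply: leq_subr.
Qed.

Lemma hsym_image_expprod y N : hsym_image y N = (expprod y N)`_N.
Proof.
have cE (z : 'I_N -> nat) : \prod_(i < N) (iota (z i)%:R^-1)%:P =
    (iota (\prod_(i < N) z i)%N%:R^-1)%:P :> {poly R}.
  by rewrite natr_prod -prodfV !rmorph_prod.
have yE (a : {ffun 'I_N -> 'I_N.+1}) : \prod_(i < N) ((y i)%:P * 'X^(i.+1)) ^+ a i =
    (\prod_(i < N) y i ^+ a i)%:P * 'X^(\sum_(i < N) a i * i.+1).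
  under eq_bigr => i _ do rewrite exprMn -exprM mulnC.
  rewrite big_split /= -expr_sum rmorph_prod; congr (_ * _).
  by apply: eq_bigr => i _; rewrite rmorphXn.
rewrite /expprod /expfac bigA_distr_bigA /= coef_sum /hsym_image [LHS]big_mkcond.
apply: eq_bigr => a _; rewrite [in RHS]big_split /=.
rewrite (cE (fun i => ((a i)`! * i.+1 ^ a i)%N)) yE !coefCM coefXn eq_sym.
by case: eqP; rewrite ?mulr1 ?mulr0.
Qed.

Lemma natrS_injR n (u v : R) : n.+1%:R * u = n.+1%:R * v -> u = v.
Proof.
move/(congr1 (fun x => iota n.+1%:R^-1 * x)); rewrite !mulrA.
by rewrite -(rmorph_nat iota) -rmorphM mulVf ?natr_neq0 // rmorph1 !mul1r.
Qed.

Lemma expprod_newton y N k : (k < N)%N ->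
  k.+1%:R * (expprod y N)`_k.+1 = \sum_(j < k.+1) y j * (expprod y N)`_(k - j).
Proof.
move=> kN; rewrite mulr_natl -coef_deriv expprod_deriv // coefM.
apply: eq_bigr => j _; congr (_ * _); rewrite coef_sum.
have jN : (j < N)%N by apply: leq_ltn_trans kN; rewrite -ltnS ltn_ord.
rewrite (bigD1 (Ordinal jN)) //= coefCM coefXn eqxx mulr1 big1 ?addr0 // => i.
by rewrite -val_eqE /= => ij; rewrite coefCM coefXn eq_sym (negPf ij) mulr0.
Qed.

Lemma expprod0 y N : (expprod y N)`_0 = 1.
Proof.
rewrite /expprod; suff H M : (\prod_(i < M) expfac y N i)`_0 = 1 by exact: H.
elim: M => [|M IH]; first by rewrite big_ord0 coef1.
rewrite big_ord_recr /= coefM big_ord1 IH mul1r /expfac big_ord_recl coefD /=.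
rewrite fact0 expn0 muln1 invr1 rmorph1 mul1r expr0 coef1 coef_sum big1 ?addr0 // => a _.
by rewrite exprMn -exprM /bump /= add1n mulrA coefMXn subnn muln_gt0.
Qed.

Lemma expprod_stable y N N' k : (k <= N)%N -> (k <= N')%N ->
  (expprod y N)`_k = (expprod y N')`_k.
Proof.
elim/ltn_ind: k => -[_ _ _|k IH kN kN']; first by rewrite !expprod0.
apply: (@natrS_injR k); rewrite !expprod_newton //; apply: eq_bigr => j _.
by rewrite IH //; have := ltn_ord j; lia.
Qed.

Lemma hsym_image_newton y n :
  n.+1%:R * hsym_image y n.+1 = \sum_(k < n.+1) y k * hsym_image y (n - k).
Proof.
rewrite hsym_image_expprod expprod_newton //; apply: eq_bigr => k _; congr (_ * _).
rewrite hsym_image_expprod; apply: expprod_stable => //.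
by apply: leq_trans (leq_subr _ _) _.
Qed.

Lemma hsym_image0 y : hsym_image y 0 = 1.
Proof. by rewrite hsym_image_expprod expprod0. Qed.

End CompleteHomogeneous.

(** * Adding a row *)

Section ProdCells.

Variable R : comNzRingType.
Implicit Types (F : nat -> nat -> R) (la : seq nat).

Lemma prod_cells_cons m ka F :
  prod_cells (m :: ka) F = \prod_(j < m) F 0%N j * prod_cells ka (fun i j => F i.+1 j).
Proof. by rewrite /prod_cells /= big_ord_recl. Qed.

Lemma eq_prod_cells la F F' :
  (forall i j, (i < size la)%N -> (j < nth 0 la i)%N -> F i j = F' i j) ->
  prod_cells la F = prod_cells la F'.
Proof. by move=> FF; apply: eq_bigr => i _; apply: eq_bigr => j _; apply: FF. Qed.

Lemma prod_cellsM la F F' :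
  prod_cells la (fun i j => F i j * F' i j) = prod_cells la F * prod_cells la F'.
Proof. by rewrite -big_split; apply: eq_bigr => i _; rewrite big_split. Qed.

Lemma prod_cells_const la (c : R) : prod_cells la (fun _ _ => c) = c ^+ sumn la.
Proof.
elim: la => [|m ka IH]; first by rewrite /prod_cells big_ord0.
by rewrite prod_cells_cons IH big_const card_ord iter_mulr_1 -exprD.
Qed.

Lemma prod_cells_columns la b F : is_part la -> (head 0 la <= b)%N ->
  prod_cells la F = \prod_(j < b) \prod_(i < count (fun r => j < r)%N la) F i j.
Proof.
elim: la b F => [|m ka IH] b F pl mb.
  by rewrite /prod_cells big_ord0 big1 // => j _; rewrite big_ord0.
have pk : is_part ka := is_part_behead pl; move: pl; rewrite is_part_cons => /and3P[_ km _].
rewrite prod_cells_cons (IH b) //; last exact: leq_trans km mb.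
rewrite (big_ord_widen b (fun j => F 0%N j)) // big_mkcond -big_split /=.
apply: eq_bigr => j _; case: ifP => jm; first by rewrite add1n big_ord_recl.
have -> : count (fun r : nat => (j < r)%N) ka = 0%N.
  apply/eqP; rewrite -leqn0 leqNgt -has_count; apply/negP => /hasP[r /(nthP 0%N)[i ik <-] /= jr].
  by have := is_part_nth_le pk (leq0n i); rewrite nth0; lia.
by rewrite addn0 !big_ord0 mulr1.
Qed.

Lemma prod_cells_row m ka F : is_part (m :: ka) ->
  prod_cells (m :: ka) F =
    prod_cells ka F * \prod_(j < m) F (count (fun r => j < r)%N ka) j.
Proof.
move=> pl; have pk : is_part ka := is_part_behead pl.
rewrite (prod_cells_columns (b := m) _ pl) // (prod_cells_columns (b := m) _ pk); last first.
  by move: pl; rewrite is_part_cons => /and3P[].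
rewrite -big_split; apply: eq_bigr => j _ /=.
by rewrite ltn_ord add1n big_ord_recr.
Qed.

End ProdCells.

Lemma prod_cells_rmorph (R R' : comNzRingType) (f : {rmorphism R -> R'}) la F :
  f (prod_cells la F) = prod_cells la (fun i j => f (F i j)).
Proof. by rewrite rmorph_prod; apply: eq_bigr => i _; rewrite rmorph_prod. Qed.

Lemma prod_cells_neq0 (R : idomainType) la (F : nat -> nat -> R) :
  (forall i j, (i < size la)%N -> (j < nth 0 la i)%N -> F i j != 0) ->
  prod_cells la F != 0.
Proof.
move=> F0; apply/prodf_neq0 => i _; apply/prodf_neq0 => j _.
exact: F0.
Qed.

Lemma div_rescale (F : fieldType) (n d f vm vs e : F) : vm != 0 -> vs != 0 -> e != 0 ->
  n / (vs^-1 * e) * vm * d * ((vm * vs)^-1 * f) = n * d * f / e.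
Proof. by move=> h1 h2 h3; field; rewrite h1 h2 h3. Qed.

Section RowAddition.

Variables (K : fieldType) (q t : K).
Hypothesis charK : [pchar K] =i pred0.
Hypothesis generic : forall a b, (0 < a + b)%N -> q ^+ a * t ^+ b != 1.

Let w k : K := (1 - q ^+ k) / (1 - t ^+ k).
Variable S : symfun_theory w.

Local Notation A := (sf_alg S).
Local Notation p := (sf_p S).
Local Notation D := (sf_skew S).
Local Notation B := (@sf_pair _ _ S).
Local Notation mc := (coef_seq (@sf_eps _ _ S) D).
Implicit Types (f g h : A) (la mu nu ta rho : seq nat).

Variables (E G : nat -> A) (P : seq nat -> A).
Hypothesis newtonE : newton p (fun=> -1) E.
Hypothesis newtonG : newton p (fun k => (1 - t ^+ k) / (1 - q ^+ k)) G.
Hypothesis P_dom : forall la al, is_part la -> mc al (P la) != 0 -> dom al la.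
Hypothesis P_lead : forall la, is_part la -> mc la (P la) = 1.
Hypothesis P_orth : forall la mu, is_part la -> is_part mu -> la != mu -> B (P la) (P mu) = 0.

Local Notation N la := (B (P la) (P la)).

Let N_neq0 la : is_part la -> N la != 0 := P_norm_neq0 P_dom P_lead P_orth (la := la).

Lemma norm_row m ka : is_part (m :: ka) ->
  N (m :: ka) * \prod_(j < m) (1 - q ^+ (m - j.+1) * t ^+ (count (fun r => j < r)%N ka).+1) =
  N ka * \prod_(j < m) (1 - q ^+ (m - j) * t ^+ count (fun r => j < r)%N ka).
Proof.
elim: m ka => [|m IH] ka pl; first by rewrite is_part_cons in pl.
have pk : is_part ka := is_part_behead pl; have prk := is_part_remove_column pk.
have cn := norm_corner charK generic newtonE newtonG P_dom P_lead P_orth pl.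
have c0 : count (fun r => 0 < r)%N ka = size ka.
  apply/eqP; rewrite -all_count; apply/allP => r /(nthP 0%N)[i ik <-].
  by rewrite (is_part_nth_gt0 i pk).
rewrite !big_ord_recl /= c0 subn0 subSS subn0.
have cE j : count (fun r => bump 0 j < r)%N ka = count (fun r => j < r)%N (remove_column ka).
  by rewrite count_remove_column.
under eq_bigr => j _ do rewrite cE /bump add1n subSS.
under [in RHS]eq_bigr => j _ do rewrite cE /bump add1n subSS.
apply: (mulIf (N_neq0 prk)); move: cn; rewrite remove_column_cons //.
case: m IH pl => [|m] IH pl.
  rewrite /= !big_ord0 !mulr1 remove_column_nil //; last first.
    by move: pl; rewrite is_part_cons => /and3P[].
  move: (N [::]) (N (1%N :: ka)) (N ka) => x y z cn.
  transitivity ((1 - q ^+ 0 * t ^+ (size ka).+1) * x * y); first by ring.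
  by rewrite -cn; ring.
rewrite [in X in X -> _]/= => cn.
have pr : is_part (m.+1 :: remove_column ka).
  by have := is_part_remove_column pl; rewrite remove_column_cons.
have := IH _ pr; move: cn.
move: (\prod_(j < _) _) (\prod_(j < _) _).
move: (N (m.+1 :: remove_column ka)) (N (remove_column ka)) (N (m.+2 :: ka)) (N ka).
move=> x y z u b a h1 h2.
transitivity ((1 - q ^+ m.+1 * t ^+ (size ka).+1) * y * z * a); first by ring.
rewrite -h1; transitivity ((1 - q ^+ m.+2 * t ^+ size ka) * u * (x * a)); first by ring.
by rewrite h2; ring.
Qed.

Definition hook_prod la : K :=
  prod_cells la (fun i j => 1 - q ^+ arm la i j * t ^+ (leg la i j).+1).

Lemma hook_prod_cons m ka : is_part (m :: ka) -> hook_prod (m :: ka) =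
  \prod_(j < m) (1 - q ^+ (m - j.+1) * t ^+ (count (fun r => j < r)%N ka).+1) * hook_prod ka.
Proof.
move=> pl; have pk : is_part ka := is_part_behead pl.
rewrite /hook_prod prod_cells_cons; congr (_ * _).
  by apply: eq_bigr => j _; rewrite /arm /leg /= ltn_ord add1n subSS subn0.
apply: eq_prod_cells => i j ik jk; congr (1 - _ ^+ _ * _ ^+ _.+1).
rewrite /leg /= (_ : j < m)%N ?add1n ?subSS //.
apply: leq_trans jk _; apply: leq_trans (is_part_nth_le pk (leq0n i)) _.
by move: pl; rewrite nth0 is_part_cons => /and3P[].
Qed.

Lemma hook_prod_neq0 la : hook_prod la != 0.
Proof.
apply: prod_cells_neq0 => i j _ _; rewrite subr_eq0 eq_sym generic //.
by rewrite addnS.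
Qed.

Local Notation J la := (hook_prod la *: P la).
Local Notation L := (ratfun K).
Local Notation tofrac := (@FracField.tofrac {poly K}).

Variables (AL : lmodType L) (emb : A -> AL) (ev : K -> AL -> A).
Hypothesis embD : forall f g, emb (f + g) = emb f + emb g.
Hypothesis embZ : forall c f, emb (c *: f) = rconst c *: emb f.
Hypothesis evE : forall a (s : seq (seq nat)) (num : seq nat -> {poly K}) d (F : seq nat -> A),
  d.[a] != 0 ->
  ev a (\sum_(la <- s) (tofrac (num la) / tofrac d) *: emb (F la))
    = \sum_(la <- s) ((num la).[a] / d.[a]) *: F la.

Variables (nabla nablaV : A -> A).
Hypothesis nablaE : forall la, is_part la -> nabla (J la) =
  ((-1) ^+ sumn la * prod_cells la (fun i j => q ^+ j * t ^- i)) *: J la.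
Hypothesis nablaK : cancel nabla nablaV.
Hypothesis nablaVZ : forall c f, nablaV (c *: f) = c *: nablaV f.

Variables (Delta DeltaV : AL -> AL).
Hypothesis DeltaD : forall x y, Delta (x + y) = Delta x + Delta y.
Hypothesis DeltaZ : forall c x, Delta (c *: x) = c *: Delta x.
Hypothesis DeltaVZ : forall c x, DeltaV (c *: x) = c *: DeltaV x.
Hypothesis DeltaK : cancel Delta DeltaV.
Hypothesis DeltaE : forall la, is_part la -> Delta (emb (J la)) =
  prod_cells la (fun i j => 1 - (rv K)^-1 * (rconst q ^+ j * rconst t ^- i)) *: emb (J la).

(* Multiplication by the coefficient of u^m in Exp[u v (1-t)/(1-q) X]. *)
Variable mulExp : nat -> AL -> AL.
Hypothesis mulExpZ : forall m c x, mulExp m (c *: x) = c *: mulExp m x.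
Hypothesis mulExpE : forall m f, mulExp m (emb f) = rv K ^+ m *: emb (G m * f).

Let nab la : K := (-1) ^+ sumn la * prod_cells la (fun i j => q ^+ j * t ^- i).
Let eig la : {poly K} := prod_cells la (fun i j => 'X - (q ^+ j * t ^- i)%:P).
Let eigV la : L :=
  prod_cells la (fun i j => 1 - (rv K)^-1 * (rconst q ^+ j * rconst t ^- i)).

Hypotheses (q_neq0 : q != 0) (t_neq0 : t != 0).

Let rv_neq0 : rv K != 0.
Proof. by rewrite /rv tofrac_eq0 polyX_eq0. Qed.

Let nab_neq0 la : nab la != 0.
Proof.
rewrite mulf_neq0 ?signr_eq0 //; apply: prod_cells_neq0 => i j _ _.
by rewrite mulf_neq0 ?invr_eq0 ?expf_neq0.
Qed.

Let eigVE la : eigV la = rv K ^- sumn la * tofrac (eig la).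
Proof.
rewrite prod_cells_rmorph -exprVn -prod_cells_const -prod_cellsM.
apply: eq_prod_cells => i j _ _; rewrite rmorphB /= mulrBr mulVf //.
pose rc : {rmorphism K -> L} := tofrac \o polyC.
have -> : tofrac (q ^+ j * t ^- i)%:P = rc (q ^+ j * t ^- i) by [].
by rewrite rmorphM fmorphV !rmorphXn.
Qed.

Let DeltaV_J la : is_part la -> Delta (emb (J la)) = eigV la *: emb (J la) :=
  DeltaE (la := la).

Let eig_neq0 la : eig la != 0.
Proof. by apply: prod_cells_neq0 => i j _ _; rewrite polyXsubC_eq0. Qed.

Let eigV_neq0 la : eigV la != 0.
Proof.
rewrite eigVE; apply: mulf_neq0; first by rewrite invr_eq0; apply: expf_neq0 rv_neq0.
by rewrite tofrac_eq0; apply: eig_neq0.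
Qed.

Let horner_eig la a : (eig la).[a] = prod_cells la (fun i j => a - q ^+ j * t ^- i).
Proof.
rewrite -[LHS]/(horner_eval a _) prod_cells_rmorph; apply: eq_prod_cells => i j _ _.
by rewrite /= /horner_eval hornerXsubC.
Qed.

Let horner_eig_wide la m : is_part la -> (m < head 0 la)%N -> (eig la).[q ^+ m] = 0.
Proof.
case: la => // k ka _ /= mk; rewrite horner_eig prod_cells_cons.
by rewrite (bigD1 (Ordinal mk)) //= expr0 invr1 mulr1 subrr !mul0r.
Qed.

Let horner_eig_narrow la m : is_part la -> (head 0 la <= m)%N ->
  (eig la).[q ^+ m] = nab la * prod_cells la (fun i j => 1 - q ^+ (m - j) * t ^+ i).
Proof.
move=> pl lm; rewrite horner_eig /nab -prod_cells_const -!prod_cellsM.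
apply: eq_prod_cells => i j il jl.
have jm : (j <= m)%N.
  by apply: leq_trans lm; have := is_part_nth_le pl (leq0n i); rewrite nth0; lia.
have t0 : t ^+ i != 0 by rewrite expf_neq0.
rewrite -{1}(subnK jm) exprD; move: (q ^+ (m - j)) (q ^+ j) (t ^+ i) t0 => x y z z0.
by field.
Qed.

Let scaled_norm m mu : is_part (m :: mu) ->
  B (G m * J mu) (P (m :: mu)) / (N (m :: mu) * hook_prod (m :: mu)) *
    \prod_(j < m) (1 - q ^+ (m - j) * t ^+ count (fun r => j < r)%N mu) = 1.
Proof.
move=> pl; have pm : is_part mu := is_part_behead pl.
rewrite -scalerAr sf_pairZl [B (G m * P mu) _]sf_pairC.
rewrite [B (P (m :: mu)) (G m * _)](row_pieri_lead charK generic newtonG P_dom P_lead P_orth pm pl).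
rewrite hook_prod_cons //; have := norm_row pl.
have := N_neq0 pl; have := N_neq0 pm; have := hook_prod_neq0 mu.
have := hook_prod_neq0 (m :: mu); rewrite hook_prod_cons // mulf_eq0 negb_or => /andP[].
move: (N (m :: mu)) (N mu) (hook_prod mu) (\prod_(j < m) _) (\prod_(j < m) _).
move=> x y z v u u0 z0 _ y0 x0 h.
have -> : z * y / (x * (u * z)) * v = y * v / (x * u) by field; rewrite x0 u0.
by rewrite -h divff // mulf_neq0.
Qed.

Lemma Gamma_row m mu : is_part (m :: mu) ->
  nablaV (ev (q ^+ m) (Delta (mulExp m (DeltaV (emb (nabla (J mu))))))) = J (m :: mu).
Proof.
move=> pl; have pm : is_part mu := is_part_behead pl.
have mm : (head 0 mu <= m)%N by move: pl; rewrite is_part_cons => /and3P[].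
have [b [lb GJ]] := P_expansion_pair P_dom P_lead P_orth (G m * J mu) (sumn (m :: mu)).
pose d nu := B (G m * J mu) (P nu) / (N nu * hook_prod nu).
have {}GJ : G m * J mu = \sum_(nu <- parts_upto b) d nu *: J nu.
  rewrite {1}GJ; apply: eq_big_seq => nu nb; rewrite scalerA /d invfM mulrA.
  by rewrite divfK // hook_prod_neq0.
have d_dom nu : is_part nu -> d nu != 0 -> dom (m :: mu) nu.
  move=> pn; rewrite /d mulf_eq0 negb_or -scalerAr sf_pairZl mulf_eq0 negb_or sf_pairC.
  move=> /andP[/andP[_ h] _].
  exact: (row_pieri_support charK generic newtonG P_dom P_lead P_orth pn pm h).
have emb0 : emb 0 = 0.
  by rewrite -[X in emb X](scale0r 0) embZ /rconst polyC0 tofrac0 scale0r.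
have Delta0 : Delta 0 = 0 by rewrite -[X in Delta X](scale0r 0) DeltaZ scale0r.
have DVE : DeltaV (emb (J mu)) = (eigV mu)^-1 *: emb (J mu).
  apply: (canLR DeltaK).
  rewrite DeltaZ.
  rewrite (DeltaV_J pm).
  rewrite scalerA.
  rewrite (mulVf (eigV_neq0 mu)).
  by rewrite scale1r.
have step1 : Delta (mulExp m (DeltaV (emb (nabla (J mu))))) =
    \sum_(nu <- parts_upto b) (tofrac ((nab mu * d nu) *: eig nu) / tofrac (eig mu)) *: emb (J nu).
  rewrite nablaE // -/(nab mu) embZ DeltaVZ DVE !mulExpZ mulExpE GJ (big_morph emb embD emb0).
  rewrite !DeltaZ (big_morph Delta DeltaD Delta0) !scalerA scaler_sumr.
  apply: eq_big_seq => nu /parts_upto_part pn.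
  rewrite embZ DeltaZ (DeltaV_J pn) !scalerA; congr (_ *: _).
  have [->|d0] := eqVneq (d nu) 0.
    have r0 : rconst (0 : K) = 0 by rewrite /rconst polyC0 tofrac0.
    by rewrite r0 [nab mu * 0]mulr0 scale0r tofrac0 !(mulr0, mul0r).
  have [ms _] := d_dom nu pn d0; rewrite !eigVE -ms /= -mul_polyC tofracM polyCM tofracM.
  rewrite -!/(rconst _) exprD.
  have vm0 : rv K ^+ m != 0 := expf_neq0 _ rv_neq0.
  have vs0 : rv K ^+ sumn mu != 0 := expf_neq0 _ rv_neq0.
  have e0 : tofrac (eig mu) != 0 by rewrite tofrac_eq0; apply: eig_neq0.
  exact: (div_rescale _ _ _ vm0 vs0 e0).
have em0 : (eig mu).[q ^+ m] != 0.
  rewrite horner_eig_narrow // mulf_neq0 ?nab_neq0 //; apply: prod_cells_neq0 => i j il jl.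
  rewrite subr_eq0 eq_sym generic // addn_gt0 subn_gt0.
  by have := is_part_nth_le pm (leq0n i); rewrite nth0; lia.
rewrite step1 evE // (bigD1_seq (m :: mu)) ?undup_uniq ?mem_parts_upto //=.
rewrite big1_seq ?addr0 => [|nu /andP[nm /parts_upto_part pn]].
  rewrite hornerZ !horner_eig_narrow // nablaVZ.
  have nJ : nablaV (J (m :: mu)) = (nab (m :: mu))^-1 *: J (m :: mu).
    have e : nablaV (nab (m :: mu) *: J (m :: mu)) = J (m :: mu) by rewrite -(nablaE pl) nablaK.
    apply: (scalerI (nab_neq0 (m :: mu))); rewrite -nablaVZ e.
    by rewrite [RHS](scalerA (nab (m :: mu)) (nab (m :: mu))^-1 (J (m :: mu)))
      (divff (nab_neq0 _)) scale1r.
  rewrite nJ scalerA (prod_cells_row _ pl).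
  rewrite -[RHS]scale1r; congr (_ *: _); rewrite -[RHS](scaled_norm pl) -/(d (m :: mu)).
  have f0 : prod_cells mu (fun i j => 1 - q ^+ (m - j) * t ^+ i) != 0.
    by move: em0; rewrite horner_eig_narrow // mulf_eq0 negb_or => /andP[].
  have n1 := nab_neq0 mu; have n2 := nab_neq0 (m :: mu).
  move: (nab mu) (nab (m :: mu)) (d _) (prod_cells _ _) (\prod_(j < m) _) f0 n1 n2.
  by move=> x y z u v u0 x0 y0; field; rewrite x0 y0 u0.
have [d0|d0] := eqVneq (d nu) 0.
  by rewrite d0 mulr0 scale0r horner0 mul0r scale0r.
have [h1 h2] := d_dom nu pn d0.
have hm : (m <= head 0 nu)%N.
  by have := h2 1%N; rewrite !sumn_take_behead !take0 !addn0.
have [hm'|hm'] := ltnP m (head 0 nu).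
  by rewrite hornerZ horner_eig_wide // mulr0 mul0r scale0r.
have hE : head 0%N nu = m by apply/eqP; rewrite eqn_leq hm hm'.
have m0 : (0 < m)%N by move: pl; rewrite is_part_cons => /and3P[].
have [ea _] := extremalP charK generic newtonE newtonG P_dom P_lead P_orth pn.
case/eqP: nm; rewrite (head_behead_part pn hE m0); congr (_ :: _); apply/esym/ea => //.
rewrite hE; move: d0; rewrite /d mulf_eq0 negb_or -scalerAr sf_pairZl mulf_eq0 negb_or sf_pairC.
by move=> /andP[/andP[_ h] _].
Qed.

End RowAddition.

Section SymfunInstance.

Variables (K : fieldType) (w : nat -> K).
Hypothesis charK : [pchar K] =i pred0.
Hypothesis w_neq0 : forall k, w k.+1 != 0.

Lemma coef_seq_mcoef al (f : symfun K) : coef_seq (mcoef [::]) (@skewp K) al f = mcoef al f.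
Proof. by elim: al f => //= a al IH f; rewrite IH. Qed.

Lemma mcoef_nil_psumM i (f : symfun K) : mcoef [::] (psum K i.+1 * f) = 0.
Proof. by rewrite mcoef_psumM big_ord0. Qed.

Lemma coef_seq_mcoef_inj (f : symfun K) :
  (forall al, coef_seq (mcoef [::]) (@skewp K) al f = 0) -> f = 0.
Proof. by move=> f0; apply: (mcoef_inj charK) => al; rewrite -coef_seq_mcoef. Qed.

Definition symfun_instance : symfun_theory w :=
  @SymfunTheory K w (symfun K : comAlgType K) (fun i => psum K i.+1) (@skewp K) (@der K)
    (@mcoef K [::]) (pairing w) (@symfun_ind K) (@skew0 K) (@skew_one K) (@skewM K)
    (@skew_psumM K) (@der_one K) (@der_psumM K) mcoef_nil_psumM
    (pairingDl w) (pairingZl w) (pairingC w) (pairing_psuml w)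
    (pairing_inj charK w_neq0) coef_seq_mcoef_inj.

End SymfunInstance.

(** * Specialisation to the ring of symmetric functions *)

Section HsymPlethysm.

Variables (K : fieldType) (R : comNzRingType) (iota : {rmorphism K -> R}).

Lemma psubst_hsym (E : nat -> R) n :
  psubst iota E (hsym K n) = hsym_image iota (fun i => E i.+1) n.
Proof.
rewrite /hsym /hsym_image [LHS]rmorph_sum; apply: eq_bigr => a _.
rewrite /= psubstZ; congr (_ * _); rewrite rmorph_prod; apply: eq_bigr => i _.
by rewrite rmorphXn /= psubst_psum.
Qed.

Lemma hsym_image_scale x y n :
  hsym_image iota (fun i => x ^+ i.+1 * y i) n = x ^+ n * hsym_image iota y n.
Proof.
rewrite /hsym_image mulr_sumr; apply: eq_bigr => a /eqP an.
rewrite mulrCA; congr (_ * _).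
have -> : x ^+ n = \prod_(i < n) x ^+ (a i * i.+1) by rewrite -expr_sum an.
rewrite -big_split.
by apply: eq_bigr => i _; rewrite exprMn -exprM mulnC.
Qed.

Lemma eq_hsym_image y y' n : y =1 y' -> hsym_image iota y n = hsym_image iota y' n.
Proof. by move=> yy; apply: eq_bigr => a _; congr (_ * _); apply: eq_bigr => i _; rewrite yy. Qed.

Lemma hsym_image_rmorph (R' : comNzRingType) (f : {rmorphism R -> R'}) y n :
  f (hsym_image iota y n) = hsym_image (f \o iota) (f \o y) n.
Proof.
rewrite rmorph_sum; apply: eq_bigr => a _; rewrite rmorphM; congr (_ * _).
by rewrite rmorph_prod; apply: eq_bigr => i _; rewrite rmorphXn.
Qed.

End HsymPlethysm.

Lemma hsym_image_base (K K' : fieldType) (R : comNzRingType) (f : {rmorphism K -> K'})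
    (iota : {rmorphism K' -> R}) (iota' : {rmorphism K -> R}) y n :
  iota' =1 iota \o f -> hsym_image iota' y n = hsym_image iota y n.
Proof.
by move=> ff; apply: eq_bigr => a _; rewrite ff /= fmorphV rmorph_nat.
Qed.

Lemma newton_hsym_image (K : fieldType) (A : comAlgType K) (iota : {rmorphism K -> A})
    (p : nat -> A) (c : nat -> K) : [pchar K] =i pred0 ->
  newton p c (hsym_image iota (fun i => c i.+1 *: p i)).
Proof.
by move=> charK; split=> [|n]; [apply: hsym_image0 | apply: hsym_image_newton].
Qed.

Lemma eq_newton (K : comNzRingType) (A : comAlgType K) (p : nat -> A) c H H' :
  H =1 H' -> newton p c H -> newton p c H'.
Proof.
move=> HH [H0 HS]; split=> [|n]; first by rewrite -HH.
by rewrite -HH HS; apply: eq_bigr => k _; rewrite HH.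
Qed.

Lemma newton_plet_hsym (K : fieldType) (c : nat -> K) : [pchar K] =i pred0 ->
  newton (A := symfun K : comAlgType K) (fun i => psum K i.+1) c
    (fun n => psubst (@malgC _ K) (fun k => c k *: psum K k) (hsym K n)).
Proof.
move=> charK; apply: eq_newton (newton_hsym_image _ _ _ charK) => n.
exact/esym/psubst_hsym.
Qed.

Section CountTake.

Local Open Scope nat_scope.

Lemma sumn_count b (s : seq nat) : all (fun x => x <= b) s ->
  sumn s = \sum_(v < b) count (fun x => v < x) s.
Proof.
elim: s => [|x s IH] /=; first by rewrite big1.
move=> /andP[xb /IH ->]; rewrite big_split /=; congr (_ + _).
elim: b xb {IH} => [|b IH]; first by rewrite leqn0 => /eqP ->; rewrite big_ord0.
rewrite leq_eqVlt big_ord_recr /= => /orP[/eqP ->|]; last first.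
  by rewrite ltnS => xb; rewrite -(IH xb) ltnNge xb addn0.
rewrite ltnSn (eq_bigr (fun=> 1)) => [|i _]; first by rewrite sum_nat_const card_ord muln1 addn1.
by rewrite (ltn_trans (ltn_ord i)).
Qed.

Lemma count_take_part mu v j : is_part mu ->
  count (fun x => v < x) (take j mu) = minn j (count (fun x => v < x) mu).
Proof.
elim: mu j => [|m ka IH] [|j] pm //=; rewrite ?min0n ?minn0 //.
have pk : is_part ka := is_part_behead pm; rewrite IH //.
case: (ltnP v m) => vm; first by rewrite !add1n minnSS.
suff -> : count (fun x => v < x) ka = 0 by rewrite !minn0.
apply/eqP; rewrite -leqn0 leqNgt -has_count; apply/negP => /hasP[r /(nthP 0%N)[i ik <-] /= jr].
have := is_part_nth_le pk (leq0n i); rewrite nth0.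
by move: pm; rewrite is_part_cons => /and3P[_ h _]; lia.
Qed.

Lemma mem_leq_sumn x (s : seq nat) : x \in s -> x <= sumn s.
Proof. by elim: s => //= y s IH; rewrite inE => /orP[/eqP ->|/IH]; lia. Qed.

Lemma dom_perm al mu : is_part mu -> perm_eq [seq e <- al | e != 0] mu -> dom al mu.
Proof.
move=> pm pe.
have cE v : count (fun x => v < x) al = count (fun x => v < x) mu.
  rewrite -(permP pe) count_filter; apply: eq_count => x /=.
  by case: x => [|x]; rewrite ?ltn0 ?andbT.
pose b := sumn al + sumn mu.
have ba : all (fun x => x <= b) al.
  by apply/allP => x /mem_leq_sumn h; apply: leq_trans h (leq_addr _ _).
have bm : all (fun x => x <= b) mu.
  by apply/allP => x /mem_leq_sumn h; apply: leq_trans h (leq_addl _ _).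
have bt (s : seq nat) j : all (fun x => x <= b) s -> all (fun x => x <= b) (take j s).
  by move/allP => h; apply/allP => x /mem_take/h.
split=> [|j].
  by rewrite (sumn_count ba) (sumn_count bm); apply: eq_bigr => v _; rewrite cE.
rewrite (sumn_count (bt _ j ba)) (sumn_count (bt _ j bm)); apply: leq_sum => v _.
rewrite (count_take_part _ _ pm) leq_min -cE; apply/andP; split.
  apply: leq_trans (count_size _ _) _; rewrite size_take; case: ltnP => //.
by rewrite -{2}(cat_take_drop j al) count_cat leq_addr.
Qed.

End CountTake.

Lemma sumn_filter_neq0 (s : seq nat) : sumn [seq e <- s | e != 0%N] = sumn s.
Proof. by elim: s => //= -[|x] s IH //=; rewrite IH. Qed.

Lemma mcoeff_msym_poly (K : comNzRingType) n (mu : seq nat) (al : mpoly.multinom n) :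
  mpoly.mcoeff al (msym_poly K n mu) = (perm_eq [seq e <- al | e != 0%N] mu)%:R.
Proof.
rewrite /msym_poly raddf_sum /=; case: (boolP (perm_eq _ mu)) => [pe|npe]; last first.
  rewrite big1 // => a pa; rewrite mpoly.mcoeffX; case: eqP => // e.
  by case/negP: npe; rewrite -e.
have da : (mpoly.mdeg al < (sumn mu).+1)%N.
  rewrite ltnS -(perm_sumn pe) /mpoly.mdeg sumn_filter_neq0.
  by rewrite sumnE.
rewrite (bigD1 (BMultinom da)) //= mpoly.mcoeffX eqxx big1 ?addr0 // => a /andP[_ na].
by rewrite mpoly.mcoeffX; case: eqP => // e; case/eqP: na; apply: val_inj.
Qed.

Section MacdonaldP.

Variables (K : fieldType) (q t : K) (P : seq nat -> symfun K).
Hypothesis charK : [pchar K] =i pred0.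
Hypothesis hP : is_macdonaldP q t P.

Lemma mcoef_in_vars al (f : symfun K) :
  mcoef al f = mpoly.mcoeff (Multinom (in_tuple al)) (in_vars (size al) f).
Proof. by rewrite mcoeff_in_vars. Qed.

Lemma macdonaldP_mcoef la : is_part la -> exists (c : seq nat -> K) (s : seq (seq nat)),
  {in s, forall mu, is_part mu /\ strictly_dominated mu la} /\
  forall al, mcoef al (P la) = (perm_eq [seq e <- al | e != 0%N] la)%:R +
    \sum_(mu <- s) c mu * (perm_eq [seq e <- al | e != 0%N] mu)%:R.
Proof.
move=> /(macdonaldP_triangular hP)[c [s [sd PE]]]; exists c, s; split=> // al.
rewrite mcoef_in_vars PE mpoly.mcoeffD mcoeff_msym_poly; congr (_ + _).
by rewrite raddf_sum /=; apply: eq_bigr => mu _; rewrite mpoly.mcoeffZ mcoeff_msym_poly.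
Qed.

Lemma macdonaldP_dom la al : is_part la -> mcoef al (P la) != 0 -> dom al la.
Proof.
move=> pl; have [c [s [sd PE]]] := macdonaldP_mcoef pl; rewrite PE.
case: (boolP (perm_eq _ la)) => [pe _|_]; first exact: dom_perm.
rewrite add0r => /sum_neq0_ex[mu /andP[/sd[pm [_ e h]] _]].
case: (boolP (perm_eq _ mu)) => [pe _|_]; last by rewrite mulr0 eqxx.
exact: dom_trans (dom_perm pm pe) (conj e h).
Qed.

Lemma macdonaldP_lead la : is_part la -> mcoef la (P la) = 1.
Proof.
move=> pl; have [c [s [sd PE]]] := macdonaldP_mcoef pl; rewrite PE.
have -> : [seq e <- la | e != 0%N] = la.
  by apply/all_filterP/allP => e el; apply: contraTneq el => ->; case/andP: pl.
rewrite perm_refl big1_seq ?addr0 // => mu /= /sd[pm [nm _ _]].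
case: (boolP (perm_eq _ mu)) => [pe|_]; last by rewrite mulr0.
case/eqP: nm; apply: (sorted_eq (leT := geq)).
- by move=> a b d; rewrite /geq /= => h1 h2; apply: leq_trans h2 h1.
- by move=> a b; rewrite /geq /= => /andP[h1 h2]; apply/eqP; rewrite eqn_leq h1 h2.
- by case/andP: pm.
- by case/andP: pl.
- by rewrite perm_sym.
Qed.

Lemma macdonaldP_nil : P [::] = 1.
Proof.
apply/eqP; rewrite -subr_eq0; apply/eqP; apply: (mcoef_inj charK) => al.
rewrite raddfB /= mcoef_one; case: (boolP (all _ al)) => al0.
  have -> : al = [::] ++ nseq (size al) 0%N by apply/all_pred1P.
  by rewrite mcoef_cat0 macdonaldP_lead ?subrr.
rewrite subr0; apply/eqP; apply: contraNT al0 => /(@macdonaldP_dom [::] al isT)[s0 _].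
by apply/allP => x /mem_leq_sumn; rewrite s0 leqn0.
Qed.

End MacdonaldP.

Section MapCoef.

Variables (K L : comNzRingType).

Lemma mcoeff_map_coef (phi : K -> L) (f : symfun K) m :
  phi 0 = 0 -> mcoeff m (map_coef phi f) = phi (mcoeff m f).
Proof.
move=> phi0; rewrite /map_coef raddf_sum /=.
have [mf|mf] := boolP (m \in msupp f).
  rewrite (bigD1_seq m) ?fset_uniq //= [X in X + _]mcoeffUU big1 ?addr0 // => m' /negPf nm.
  by rewrite [LHS]mcoeffU nm.
rewrite big1_seq => [|m' /= m'f].
  by rewrite (mcoeff_outdom mf).
by rewrite [LHS]mcoeffU; case: eqP => // e; rewrite e (negPf mf) in m'f.
Qed.

Variable phi : {rmorphism K -> L}.

Lemma map_coef_psubst (f : symfun K) :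
  map_coef phi f = psubst (@malgC _ L \o phi) (psum L) f.
Proof.
rewrite /psubst mmapE; apply: eq_bigr => m _.
by rewrite prod_psum_monom malgUE [RHS]mul_malgC.
Qed.

Lemma map_coefD (f g : symfun K) : map_coef phi (f + g) = map_coef phi f + map_coef phi g.
Proof. by rewrite !map_coef_psubst; exact: rmorphD. Qed.

Lemma map_coefM (f g : symfun K) : map_coef phi (f * g) = map_coef phi f * map_coef phi g.
Proof. by rewrite !map_coef_psubst; exact: rmorphM. Qed.

Lemma map_coefZ c (f : symfun K) : map_coef phi (c *: f) = phi c *: map_coef phi f.
Proof. by rewrite !map_coef_psubst psubstZ [LHS]mul_malgC. Qed.

End MapCoef.

Lemma psubst_hsym_polyX (K : fieldType) (R : comNzRingType) (iota : {rmorphism K -> R})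
    (E : nat -> R) n :
  psubst (fun c => (iota c)%:P) (fun k => (E k)%:P * 'X^k) (hsym K n) =
  (psubst iota E (hsym K n))%:P * 'X^n.
Proof.
rewrite psubst_hsym -hsym_image_polyX.
exact: (psubst_hsym (polyC \o iota : {rmorphism K -> {poly R}})).
Qed.

Lemma coef_sum_psubst_hsym (K : fieldType) (R : comNzRingType) (iota : {rmorphism K -> R})
    (E : nat -> R) m :
  (\sum_(n < m.+1) psubst (fun c => (iota c)%:P) (fun k => (E k)%:P * 'X^k) (hsym K n))`_m =
  psubst iota E (hsym K m).
Proof.
rewrite coef_sum big_ord_recr /= psubst_hsym_polyX coefCM coefXn eqxx mulr1.
rewrite big1 ?add0r // => i _; rewrite psubst_hsym_polyX coefCM coefXn.
by rewrite gtn_eqF ?mulr0.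
Qed.

Lemma psubst_hsym_scale (K : fieldType) (A : comAlgType K) (iota : {rmorphism K -> A})
    (v : K) (c : nat -> K) (p : nat -> A) m :
  psubst iota (fun k => (v ^+ k * c k) *: p k) (hsym K m) =
  v ^+ m *: psubst iota (fun k => c k *: p k) (hsym K m).
Proof.
have vA n : (v ^+ n)%:A = v%:A ^+ n :> A by rewrite exprZn expr1n.
rewrite !psubst_hsym -[X in _ *: X]mul1r scalerAl vA -hsym_image_scale.
by apply: eq_hsym_image => i; rewrite -vA -scalerAl mul1r scalerA.
Qed.

Lemma coef_psubst_hsym_ratio (K : fieldType) (A : comAlgType K) (iota : {rmorphism K -> A})
    (v : K) (b c : nat -> K) (p : nat -> A) m :
  (\sum_(n < m.+1) psubst (fun c => (iota c)%:P)
     (fun k => ((v ^+ k * b k / c k) *: p k)%:P * 'X^k) (hsym K n))`_m =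
  v ^+ m *: psubst iota (fun k => (b k / c k) *: p k) (hsym K m).
Proof.
rewrite (coef_sum_psubst_hsym iota) -psubst_hsym_scale !psubst_hsym.
by apply: eq_hsym_image => i; rewrite mulrA.
Qed.

Lemma Exp_coefE (K : fieldType) (q t v : K) m : Exp_coef q t v m =
  v ^+ m *: psubst (@malgC _ K) (fun k => ((1 - t ^+ k) / (1 - q ^+ k)) *: psum K k) (hsym K m).
Proof.
exact: (coef_psubst_hsym_ratio (A := symfun K : comAlgType K) (@malgC {cmonom nat} K) v
  (fun k => 1 - t ^+ k) (fun k => 1 - q ^+ k)).
Qed.

Lemma psubst_hsym_rmorph (K L : fieldType) (R R' : comNzRingType)
    (iota : {rmorphism K -> R}) (iota' : {rmorphism L -> R'}) (phi : {rmorphism K -> L})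
    (F : {rmorphism R -> R'}) (E : nat -> R) (E' : nat -> R') m :
  (forall c, F (iota c) = iota' (phi c)) -> (forall k, F (E k.+1) = E' k.+1) ->
  F (psubst iota E (hsym K m)) = psubst iota' E' (hsym L m).
Proof.
move=> Fi FE; rewrite !psubst_hsym hsym_image_rmorph.
rewrite (hsym_image_base (f := phi) (iota := iota')); last exact: Fi.
by apply: eq_hsym_image => i; apply: FE.
Qed.

Lemma map_coef_psubst_hsym (K L : fieldType) (phi : {rmorphism K -> L}) (c : nat -> K) m :
  map_coef phi (psubst (@malgC _ K) (fun k => c k *: psum K k) (hsym K m)) =
  psubst (@malgC _ L) (fun k => phi (c k) *: psum L k) (hsym L m).
Proof.
rewrite map_coef_psubst.
apply: (psubst_hsym_rmorph (iota := @malgC {cmonom nat} K : {rmorphism K -> symfun K})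
  (iota' := @malgC {cmonom nat} L : {rmorphism L -> symfun L}) (phi := phi)
  (F := psubst (@malgC _ L \o phi : {rmorphism K -> symfun L}) (psum L)
   : {rmorphism symfun K -> symfun L})) => [a|k].
  by rewrite [LHS]mmapC.
by rewrite [LHS]psubstZ psubst_psum [LHS]mul_malgC.
Qed.

Lemma eq_psubst_hsym (K : fieldType) (R : comNzRingType) (iota : {rmorphism K -> R})
    (E E' : nat -> R) m :
  E =1 E' -> psubst iota E (hsym K m) = psubst iota E' (hsym K m).
Proof. by move=> EE; rewrite !psubst_hsym; apply: eq_hsym_image => i; apply: EE. Qed.

Section FractionCoef.

Variable K : fieldType.

Definition rconst_rmorph : {rmorphism K -> ratfun K} :=
  @FracField.tofrac {poly K} \o polyC.

Lemma map_coef_Exp_coef (q t : K) m :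
  Exp_coef (rconst q) (rconst t) (rv K) m = rv K ^+ m *:
    map_coef (@rconst K) (psubst (@malgC _ K)
      (fun k => ((1 - t ^+ k) / (1 - q ^+ k)) *: psum K k) (hsym K m)).
Proof.
have rE k : (1 - rconst t ^+ k) / (1 - rconst q ^+ k) =
    rconst_rmorph ((1 - t ^+ k) / (1 - q ^+ k)).
  by rewrite fmorph_div !rmorphB !rmorph1 !rmorphXn.
rewrite Exp_coefE; congr (_ *: _).
rewrite [RHS](map_coef_psubst_hsym rconst_rmorph); apply: eq_psubst_hsym => k.
by rewrite rE.
Qed.

Lemma map_coef_rat_eval a (s : seq (seq nat)) (num : seq nat -> {poly K}) d
    (F : seq nat -> symfun K) :
  d.[a] != 0 ->
  map_coef (rat_eval a) (\sum_(la <- s)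
      (FracField.tofrac (num la) / FracField.tofrac d) *: map_coef (@rconst K) (F la)) =
  \sum_(la <- s) ((num la).[a] / d.[a]) *: F la.
Proof.
move=> da.
have ev0 : rat_eval a 0 = 0 :> K.
  have -> : 0 = FracField.tofrac 0 / FracField.tofrac 1 :> ratfun K by rewrite tofrac0 mul0r.
  by rewrite rat_evalE hornerC ?oner_eq0 // mul0r.
have rc0 : rconst (0 : K) = 0 := rmorph0 rconst_rmorph.
apply/malgP => m; rewrite mcoeff_map_coef // !raddf_sum /=.
transitivity (rat_eval a (FracField.tofrac (\sum_(la <- s) num la * (mcoeff m (F la))%:P) /
    FracField.tofrac d)).
  congr (rat_eval a _); rewrite raddf_sum mulr_suml; apply: eq_bigr => la _ /=.
  rewrite [LHS]mcoeffZ (mcoeff_map_coef _ _ rc0) tofracM mulrAC.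
  by rewrite -!mulrA.
rewrite (rat_evalE _ da) horner_sum mulr_suml; apply: eq_bigr => la _.
by rewrite hornerM hornerC [RHS]mcoeffZ mulrAC.
Qed.

End FractionCoef.

Section MacdonaldRows.

Variables (K : fieldType) (q t : K).
Hypothesis charK : [pchar K] =i pred0.
Hypothesis generic : forall a b, (0 < a + b)%N -> q ^+ a * t ^+ b != 1.
Hypotheses (q_neq0 : q != 0) (t_neq0 : t != 0).

Variables (P : seq nat -> symfun K) (nabla nablaV : {linear symfun K -> symfun K}).
Variables Delta DeltaV : {linear symfun (ratfun K) -> symfun (ratfun K)}.
Hypothesis hP : is_macdonaldP q t P.
Hypothesis hnabla : is_nabla q t (integral_form q t P) nabla.
Hypothesis nablaK : cancel nabla nablaV.
Hypothesis hDelta : is_Delta (rconst q) (rconst t) (rv K)^-1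
  (fun la => map_coef (@rconst K) (integral_form q t P la)) Delta.
Hypothesis DeltaK : cancel Delta DeltaV.

Let w k : K := (1 - q ^+ k) / (1 - t ^+ k).

Lemma weight_neq0 k : w k.+1 != 0.
Proof.
have qk := generic (a := k.+1) (b := 0) isT; have tk := generic (a := 0) (b := k.+1) isT.
rewrite expr0 mulr1 in qk; rewrite expr0 mul1r in tk.
by rewrite mulf_neq0 ?invr_eq0 // subr_eq0 eq_sym.
Qed.

Lemma Gamma_plus_row m mu : is_part (m :: mu) ->
  Gamma_plus q t nabla nablaV Delta DeltaV m (integral_form q t P mu) =
    integral_form q t P (m :: mu).
Proof.
pose S := symfun_instance charK weight_neq0.
have P_orth la nu : is_part la -> is_part nu -> la != nu -> @sf_pair _ _ S (P la) (P nu) = 0.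
  by move=> pl pn ln; apply: (macdonaldP_orthogonal hP).
have P_dom la al : is_part la -> coef_seq (@sf_eps _ _ S) (sf_skew S) al (P la) != 0 -> dom al la.
  move=> pl; have -> : coef_seq (@sf_eps _ _ S) (sf_skew S) al (P la) = mcoef al (P la) :=
    coef_seq_mcoef al (P la).
  exact: (macdonaldP_dom hP pl).
have P_lead la : is_part la -> coef_seq (@sf_eps _ _ S) (sf_skew S) la (P la) = 1.
  move=> pl; have -> : coef_seq (@sf_eps _ _ S) (sf_skew S) la (P la) = mcoef la (P la) :=
    coef_seq_mcoef la (P la).
  exact: (macdonaldP_lead hP pl).
pose E n := psubst (@malgC _ K) (fun k => (-1) *: psum K k) (hsym K n).
pose G n := psubst (@malgC _ K)
  (fun k => ((1 - t ^+ k) / (1 - q ^+ k)) *: psum K k) (hsym K n).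
have newtonE : newton (sf_p S) (fun=> -1) E := newton_plet_hsym (fun=> -1) charK.
have newtonG : newton (sf_p S) (fun k => (1 - t ^+ k) / (1 - q ^+ k)) G :=
  newton_plet_hsym (fun k => (1 - t ^+ k) / (1 - q ^+ k)) charK.
pose emb : symfun K -> symfun (ratfun K) := map_coef (@rconst K).
pose mulExp m x : symfun (ratfun K) := Exp_coef (rconst q) (rconst t) (rv K) m * x.
have embD f g : emb (f + g) = emb f + emb g := map_coefD (rconst_rmorph K) f g.
have embZ c f : emb (c *: f) = rconst c *: emb f := map_coefZ (rconst_rmorph K) c f.
have nablaVZ c f : nablaV (c *: f) = c *: nablaV f by apply: linearZ.
have DeltaD x y : Delta (x + y) = Delta x + Delta y by apply: raddfD.
have DeltaZ c x : Delta (c *: x) = c *: Delta x by apply: linearZ.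
have DeltaVZ c x : DeltaV (c *: x) = c *: DeltaV x by apply: linearZ.
have mulExpZ k c x : mulExp k (c *: x) = c *: mulExp k x by rewrite /mulExp -[LHS]scalerAr.
have mulExpE k f : mulExp k (emb f) = rv K ^+ k *: emb (G k * f).
  rewrite /mulExp [X in X * _](map_coef_Exp_coef q t k) -[LHS]scalerAl; congr (_ *: _).
  exact/esym/(map_coefM (rconst_rmorph K)).
move=> pl.
exact: (@Gamma_row K q t charK generic S E G P newtonE newtonG P_dom P_lead P_orth
  (symfun (ratfun K)) emb (fun a => map_coef (rat_eval a)) embD embZ (@map_coef_rat_eval K)
  nabla nablaV hnabla nablaK nablaVZ Delta DeltaV DeltaD DeltaZ DeltaVZ DeltaK hDelta
  mulExp mulExpZ mulExpE q_neq0 t_neq0 m mu pl).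
Qed.

Lemma integral_form_nil : integral_form q t P [::] = 1.
Proof.
rewrite /integral_form /prod_cells big_ord0 scale1r.
exact: (macdonaldP_nil charK hP).
Qed.

Lemma Gamma_plus_rows la : is_part la ->
  foldr (Gamma_plus q t nabla nablaV Delta DeltaV) 1 la = integral_form q t P la.
Proof.
elim: la => [_|m mu IH pl]; first exact/esym/integral_form_nil.
have pm : is_part mu := is_part_behead pl.
rewrite [LHS]/= (IH pm); exact: Gamma_plus_row.
Qed.

End MacdonaldRows.

Lemma Qqt_pchar : [pchar Qqt] =i pred0.
Proof.
move=> p; rewrite (fmorph_pchar (@FracField.tofrac (mpoly.mpoly 2 rat) \o @mpoly.mpolyC 2 rat)).
exact: Num.Theory.pchar_num.
Qed.

Lemma qt_monomial a b : qvar ^+ a * tvar ^+ b =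
  FracField.tofrac (mpoly.mpolyX rat (U_(ord0) *+ a + U_(ord_max) *+ b)%MM : mpoly.mpoly 2 rat).
Proof. by rewrite -!tofracXn -tofracM mpoly.mpolyXD !mpolyXn. Qed.

Lemma mpolyX_neq0 n (m : mpoly.multinom n) : mpoly.mpolyX rat m != 0.
Proof.
apply/eqP => /(congr1 (mpoly.mcoeff m)) /eqP.
by rewrite mpoly.mcoeffX eqxx mpoly.mcoeff0 oner_eq0.
Qed.

Lemma qvar_neq0 : qvar != 0.
Proof. by rewrite tofrac_eq0 mpolyX_neq0. Qed.

Lemma tvar_neq0 : tvar != 0.
Proof. by rewrite tofrac_eq0 mpolyX_neq0. Qed.

Lemma qt_generic a b : (0 < a + b)%N -> qvar ^+ a * tvar ^+ b != 1.
Proof.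
move=> ab; rewrite qt_monomial -tofrac1 tofrac_eq -mpoly.mpolyX0.
apply/eqP => /(congr1 (mpoly.mcoeff 0%MM)); rewrite !mpoly.mcoeffX eqxx.
case: eqP => // /mnmP e _; have := e ord0; have := e ord_max.
rewrite !mnmDE !mulmnE !mnm1E !mnm0E /=.
by case: a b ab e => [|a] [|b]; rewrite ?muln1.
Qed.

Unset Implicit Arguments.

Theorem mainTheorem1
  (P : seq nat -> symfun Qqt) (hP : is_macdonaldP qvar tvar P)
  (nabla nablaV : {linear symfun Qqt -> symfun Qqt})
  (hnabla : is_nabla qvar tvar (integral_form qvar tvar P) nabla)
  (hnablaV : cancel nabla nablaV /\ cancel nablaV nabla)
  (Delta DeltaV : {linear symfun (ratfun Qqt) -> symfun (ratfun Qqt)})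
  (hDelta : is_Delta (rconst qvar) (rconst tvar) (rv Qqt)^-1
              (fun la => map_coef (@rconst Qqt) (integral_form qvar tvar P la))
              Delta)
  (hDeltaV : cancel Delta DeltaV /\ cancel DeltaV Delta)
  (la : seq nat) (hla : is_part la) :
  foldr (Gamma_plus qvar tvar nabla nablaV Delta DeltaV) 1 la
    = integral_form qvar tvar P la.
Proof.
exact: (Gamma_plus_rows Qqt_pchar qt_generic qvar_neq0 tvar_neq0 hP hnabla hnablaV.1
  hDelta hDeltaV.1 hla).
Qed.
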